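(* Let $M$ be a strongly regular sequence and let $\gamma$ be a real number with $0<\gamma<\gamma(M)$. Then there exists a constant $d\geq 1$, depending only on $M$ and $\gamma$, such that, for any real $\sigma>0$, there exists a linear continuous operator $$T_{\gamma,\sigma}:\Lambda_{M,\sigma}(\mathbb{N})\longrightarrow\mathcal{A}_{M,d\sigma}(S_\gamma)$$ satisfying $BT_{\gamma,\sigma}\lambda=\lambda$ for every $\lambda\in\Lambda_{M,\sigma}(\mathbb{N})$.
   Context: A sequence $M=(M_j)_{j\geq 0}$ of real numbers is \emph{strongly regular} if, for some constant $A>0$: (1) $M_0=1$ and $M$ is non-decreasing; (2) $M$ is logarithmically convex, i.e. the quotients $m_j=M_{j+1}/M_j$ form a non-decreasing sequence; (3) $M_{j+k}\leq A^{j+k}M_jM_k$ for all $j,k\in\mathbb{N}$; (4) $\sum_{j\geq \ell}\frac{M_j}{(j+1)M_{j+1}}\leq A\frac{M_\ell}{M_{\ell+1}}$ for all $\ell\in\mathbb{N}$. Here $\mathbb{N}=\{0,1,2,\dots\}$. The sequence $m=(m_j)_{j\ge 0}$ is the sequence of quotients of $M$. For real $\gamma>0$, $M$ satisfies property $(\mathsf{P}_\gamma)$ if there exist a sequence $m'=(m'_j)_{j\geq 0}$ and a constant $a\geq 1$ such that $(j+1)^{-\gamma}m'_j$ increases (is non-decreasing in $j$) and $a^{-1}m_j\leq m'_j\leq a m_j$ for all $j\in\mathbb{N}$. The growth index of $M$ is $\gamma(M)=\sup\{\gamma : (\mathsf{P}_\gamma)\text{ holds}\}$; it is known that $0<\gamma(M)<\infty$.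 $\Sigma$ denotes the Riemann surface of the logarithm, $\operatorname{Arg}$ the principal determination of the argument on it, and $S_\gamma=\{z\in\Sigma : |\operatorname{Arg} z|<\gamma\pi/2\}$ (for $\gamma<2$ this is an open sector in $\mathbb{C}$). For $\sigma>0$, $\mathcal{A}_{M,\sigma}(S_\gamma)$ is the Banach space of holomorphic functions $f$ on $S_\gamma$ for which there is a constant $C$ with $|f^{(j)}(z)|\leq C\sigma^jj!M_j$ for all $j\in\mathbb{N}$, $z\in S_\gamma$, normed by the smallest such $C$. $\Lambda_{M,\sigma}(\mathbb{N})$ is the Banach space of sequences $\lambda=(\lambda_j)_{j\in\mathbb{N}}$ of complex numbers for which there is a constant $C$ with $|\lambda_j|\leq C\sigma^jj!M_j$ for all $j\in\mathbb{N}$, normed by the smallest such $C$. Each $f\in\mathcal{A}_{M,\sigma}(S_\gamma)$ and each of its derivatives extends continuously to the vertex $0$; the Borel map is $Bf=(f^{(j)}(0))_{j\in\mathbb{N}}$, where $f^{(j)}(0)=\lim_{z\to 0,\,z\in S_\gamma}f^{(j)}(z)$. *)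

(* Defs.v *)
From Stdlib Require Import Reals Arith Lra FunctionalExtensionality ProofIrrelevance.
From Coquelicot Require Import Coquelicot.
Open Scope R_scope.

(** * Strongly regular sequences and their growth index *)

Definition quotients (M : nat -> R) (j : nat) : R := M (S j) / M j.

Definition strongly_regular (M : nat -> R) : Prop :=
  exists A : R, 0 < A /\
    (M 0%nat = 1 /\ forall j, M j <= M (S j)) /\
    (forall j, quotients M j <= quotients M (S j)) /\
    (forall j k, M (j + k)%nat <= A ^ (j + k) * M j * M k) /\
    (forall l,
       let tail := fun i => M (l + i)%nat / (INR (S (l + i)) * M (S (l + i))) in
       ex_series tail /\ Series tail <= A * (M l / M (S l))).

Definition property_P (gamma : R) (M : nat -> R) : Prop :=
  exists (m' : nat -> R) (a : R), 1 <= a /\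
    (forall j, Rpower (INR (S j)) (- gamma) * m' j
               <= Rpower (INR (S (S j))) (- gamma) * m' (S j)) /\
    (forall j, / a * quotients M j <= m' j <= a * quotients M j).

Definition growth_index (M : nat -> R) : Rbar :=
  Lub_Rbar (fun gamma => 0 < gamma /\ property_P gamma M).

(** * The Riemann surface of the logarithm, in polar coordinates *)

Record Sigma : Type := mkSigma {
  modulus : R;
  Arg : R;
  modulus_pos : 0 < modulus
}.

Definition polar (z : Sigma) : R * R := (modulus z, Arg z).

Definition Sigma_UniformSpace_mixin : UniformSpace.mixin_of Sigma.
Proof.
apply (UniformSpace.Mixin Sigma (mkSigma 1 0 Rlt_0_1)
         (fun z e w => ball (polar z) e (polar w))).
- intros; apply ball_center.
- intros; now apply ball_sym.
- intros x y z e1 e2; apply ball_triangle.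
Defined.

Canonical Sigma_UniformSpace :=
  UniformSpace.Pack Sigma Sigma_UniformSpace_mixin Sigma.

(* The covering map onto the punctured plane. *)
Definition proj (z : Sigma) : C :=
  (modulus z * cos (Arg z), modulus z * sin (Arg z)).

Definition in_sector (gamma : R) (z : Sigma) : Prop :=
  Rabs (Arg z) < gamma * PI / 2.

Definition sector (gamma : R) : Type := {z : Sigma | in_sector gamma z}.

Definition punctured_nbhd {gamma : R} (z : sector gamma) :
    (sector gamma -> Prop) -> Prop :=
  subset_filter (locally' (proj1_sig z)) (in_sector gamma).

(* The vertex 0 is not a point of [Sigma]: z tends to 0 when its modulus does,
   uniformly in the argument. *)
Definition vertex (gamma : R) : (sector gamma -> Prop) -> Prop :=
  subset_filter
    (fun P => at_right 0 (fun r => forall z : Sigma, modulus z = r -> P z))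
    (in_sector gamma).

(** * Complex derivatives on a sector *)

(* Points of [Sigma] over the same complex number are isolated from one another,
   so the denominator does not vanish near z. *)
Definition is_Deriv {gamma : R} (f : sector gamma -> C) (z : sector gamma)
    (l : C) : Prop :=
  filterlim
    (fun w => ((f w - f z) / (proj (proj1_sig w) - proj (proj1_sig z)))%C)
    (punctured_nbhd z) (locally l).

Definition Deriv {gamma : R} (f : sector gamma -> C) (z : sector gamma) : C :=
  iota (T := C_CompleteNormedModule) (is_Deriv f z).

Fixpoint Deriv_n {gamma : R} (f : sector gamma -> C) (n : nat) :
    sector gamma -> C :=
  match n with
  | O => f
  | S n => Deriv (Deriv_n f n)
  end.

Definition holomorphic {gamma : R} (f : sector gamma -> C) : Prop :=
  forall z, exists l, is_Deriv f z l.

(** * Spaces of functions normed by their smallest admissible bound *)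

Record gauge (X : Type) : Type := mkGauge {
  adm :> (X -> C) -> R -> Prop;
  adm_pos : forall f c, adm f c -> 0 <= c;
  adm_zero : adm (fun _ => 0%C) 0;
  adm_plus : forall f g c d,
    adm f c -> adm g d -> adm (fun x => f x + g x)%C (c + d);
  adm_scal : forall k f c, adm f c -> adm (fun x => k * f x)%C (Cmod k * c);
  adm_separated : forall f,
    (forall eps : posreal, exists c, c < eps /\ adm f c) -> forall x, f x = 0%C
}.

Record gauge_space {X : Type} (G : gauge X) : Type := mkGaugeSpace {
  gfun :> X -> C;
  gfun_adm : exists c, adm X G gfun c
}.
Arguments mkGaugeSpace {X G}.
Arguments gfun {X G}.
Arguments gfun_adm {X G}.

Section GaugeSpace.

Context {X : Type} (G : gauge X).

Lemma gauge_space_eq (f g : gauge_space G) : (forall x, f x = g x) -> f = g.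
Proof.
destruct f as [f Hf], g as [g Hg]; simpl; intros H.
assert (E : f = g) by (now apply functional_extensionality).
subst g; f_equal; apply proof_irrelevance.
Qed.

Program Definition gs_zero : gauge_space G := mkGaugeSpace (fun _ => 0%C) _.
Next Obligation. exists 0; apply adm_zero. Qed.

Program Definition gs_plus (f g : gauge_space G) : gauge_space G :=
  mkGaugeSpace (fun x => f x + g x)%C _.
Next Obligation.
destruct (gfun_adm f) as [c Hc], (gfun_adm g) as [d Hd].
exists (c + d); now apply adm_plus.
Qed.

Program Definition gs_scal (k : C) (f : gauge_space G) : gauge_space G :=
  mkGaugeSpace (fun x => k * f x)%C _.
Next Obligation.
destruct (gfun_adm f) as [c Hc]; exists (Cmod k * c); now apply adm_scal.
Qed.

Definition gs_opp (f : gauge_space G) : gauge_space G := gs_scal (- (1))%C f.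

Definition gs_AbelianMonoid_mixin : AbelianMonoid.mixin_of (gauge_space G).
Proof.
apply (AbelianMonoid.Mixin _ gs_plus gs_zero);
  intros; apply gauge_space_eq; intros; simpl; ring.
Defined.

Canonical gs_AbelianMonoid :=
  AbelianMonoid.Pack (gauge_space G) gs_AbelianMonoid_mixin (gauge_space G).

Definition gs_AbelianGroup_mixin : AbelianGroup.mixin_of gs_AbelianMonoid.
Proof.
apply (AbelianGroup.Mixin gs_AbelianMonoid gs_opp).
intros; apply gauge_space_eq; intros; simpl; ring.
Defined.

Canonical gs_AbelianGroup :=
  AbelianGroup.Pack (gauge_space G)
    (AbelianGroup.Class _ gs_AbelianMonoid_mixin gs_AbelianGroup_mixin)
    (gauge_space G).

Definition gs_ModuleSpace_mixin :
  ModuleSpace.mixin_of C_AbsRing gs_AbelianGroup.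
Proof.
apply (ModuleSpace.Mixin C_AbsRing gs_AbelianGroup gs_scal);
  intros; apply gauge_space_eq; intros;
  unfold plus, mult, one; simpl; ring.
Defined.

Definition gs_ModuleSpace_class :
    ModuleSpace.class_of C_AbsRing (gauge_space G) :=
  ModuleSpace.Class C_AbsRing (gauge_space G)
    (AbelianGroup.Class _ gs_AbelianMonoid_mixin gs_AbelianGroup_mixin)
    gs_ModuleSpace_mixin.

Canonical gs_ModuleSpace :=
  ModuleSpace.Pack C_AbsRing (gauge_space G) gs_ModuleSpace_class
    (gauge_space G).

Definition gs_norm (f : gauge_space G) : R := real (Glb_Rbar (adm X G f)).

Lemma gs_norm_glb (f : gauge_space G) :
  is_glb_Rbar (adm X G f) (Finite (gs_norm f)).
Proof.
unfold gs_norm.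
pose proof (Glb_Rbar_correct (adm X G f)) as H.
destruct (gfun_adm f) as [c Hc].
destruct H as [H1 H2].
assert (L := H1 c Hc).
assert (U : Rbar_le 0 (Glb_Rbar (adm X G f))).
{ apply H2; intros x Hx; simpl; now apply (adm_pos X G f). }
destruct (Glb_Rbar (adm X G f)) as [r| |]; simpl in *; try easy.
Qed.

Lemma gs_norm_le (f : gauge_space G) c : adm X G f c -> gs_norm f <= c.
Proof. intros H; exact (proj1 (gs_norm_glb f) c H). Qed.

Lemma gs_norm_approx (f : gauge_space G) e :
  0 < e -> exists c, c < gs_norm f + e /\ adm X G f c.
Proof.
intros He.
destruct (Classical_Prop.classic (exists c, c < gs_norm f + e /\ adm X G f c))
  as [H|H]; trivial.
exfalso.
assert (L : Rbar_le (gs_norm f + e) (gs_norm f)).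
{ apply (proj2 (gs_norm_glb f)); intros c Hc; simpl.
  apply Rnot_lt_le; intros Hl; apply H; now exists c. }
simpl in L; lra.
Qed.

Lemma gs_norm_triangle (f g : gauge_space G) :
  gs_norm (gs_plus f g) <= gs_norm f + gs_norm g.
Proof.
apply le_epsilon; intros e He.
destruct (gs_norm_approx f (e / 2)) as [c [Hc Ac]]; [lra|].
destruct (gs_norm_approx g (e / 2)) as [d [Hd Ad]]; [lra|].
apply Rle_trans with (c + d); [|lra].
apply gs_norm_le; simpl; now apply adm_plus.
Qed.

Lemma gs_norm_scal k (f : gauge_space G) :
  gs_norm (gs_scal k f) <= Cmod k * gs_norm f.
Proof.
apply le_epsilon; intros e He.
assert (Hk := Cmod_ge_0 k).
destruct (gs_norm_approx f (e / (Cmod k + 1))) as [c [Hc Ac]].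
{ apply Rdiv_lt_0_compat; lra. }
apply Rle_trans with (Cmod k * c).
{ apply gs_norm_le; simpl; now apply adm_scal. }
apply Rle_trans with (Cmod k * (gs_norm f + e / (Cmod k + 1))).
{ apply Rmult_le_compat_l; lra. }
rewrite Rmult_plus_distr_l; apply Rplus_le_compat_l.
replace (Cmod k * (e / (Cmod k + 1))) with (e - e / (Cmod k + 1)) by (field; lra).
assert (0 < e / (Cmod k + 1)) by (apply Rdiv_lt_0_compat; lra).
lra.
Qed.

Lemma gs_norm_eq_zero (f : gauge_space G) : gs_norm f = 0 -> f = gs_zero.
Proof.
intros H; apply gauge_space_eq; simpl; apply (adm_separated X G).
intros [e He]; simpl.
destruct (gs_norm_approx f e He) as [c [Hc Ac]].
exists c; split; trivial; lra.
Qed.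

Lemma gs_norm_opp (f : gauge_space G) : gs_norm (gs_opp f) <= gs_norm f.
Proof.
eapply Rle_trans; [apply gs_norm_scal|].
rewrite Cmod_opp, Cmod_1; lra.
Qed.

Definition gs_UniformSpace_mixin : UniformSpace.mixin_of (gauge_space G).
Proof.
apply (UniformSpace.Mixin (gauge_space G) gs_zero
         (fun f e g => gs_norm (minus g f) < e)).
- intros f e.
  assert (E : minus f f = gs_zero).
  { apply gauge_space_eq; intros; simpl; ring. }
  rewrite E.
  apply Rle_lt_trans with 0; [|apply cond_pos].
  apply gs_norm_le; simpl; apply adm_zero.
- intros f g e H.
  eapply Rle_lt_trans; [|exact H].
  replace (minus f g) with (gs_opp (minus g f)); [apply gs_norm_opp|].
  apply gauge_space_eq; intros; simpl; ring.
- intros f g h e1 e2 H1 H2.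
  replace (minus h f) with (gs_plus (minus h g) (minus g f)).
  + eapply Rle_lt_trans; [apply gs_norm_triangle|]; lra.
  + apply gauge_space_eq; intros; simpl; ring.
Defined.

Canonical gs_UniformSpace :=
  UniformSpace.Pack (gauge_space G) gs_UniformSpace_mixin (gauge_space G).

Canonical gs_NormedModuleAux :=
  NormedModuleAux.Pack C_AbsRing (gauge_space G)
    (NormedModuleAux.Class C_AbsRing (gauge_space G) gs_ModuleSpace_class
       gs_UniformSpace_mixin) (gauge_space G).

Definition gs_NormedModule_mixin :
  NormedModule.mixin_of C_AbsRing gs_NormedModuleAux.
Proof.
apply (NormedModule.Mixin C_AbsRing gs_NormedModuleAux gs_norm 1).
- exact gs_norm_triangle.
- exact gs_norm_scal.
- intros f g e H; exact H.
- intros f g e H; rewrite Rmult_1_l; exact H.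
- exact gs_norm_eq_zero.
Defined.

Canonical gs_NormedModule :=
  NormedModule.Pack C_AbsRing (gauge_space G)
    (NormedModule.Class C_AbsRing (gauge_space G)
       (NormedModuleAux.class C_AbsRing gs_NormedModuleAux)
       gs_NormedModule_mixin) (gauge_space G).

End GaugeSpace.

(** * The spaces of sequences and of ultraholomorphic functions *)

Definition weight (M : nat -> R) (sigma : R) (j : nat) : R :=
  sigma ^ j * INR (fact j) * M j.

(* Since [weight M sigma 0 = M 0 = 1], the requirement [0 <= c] is automatic for
   strongly regular M; it makes the norm well defined for every M. *)
Definition Lambda_adm (M : nat -> R) (sigma : R) (lambda : nat -> C) (c : R) :
    Prop :=
  0 <= c /\ forall j, Cmod (lambda j) <= c * weight M sigma j.

(* Holomorphic functions have holomorphic derivatives of all orders; spelling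
   this out guarantees that each [Deriv_n f j] is a genuine derivative. *)
Definition A_adm (M : nat -> R) (sigma gamma : R) (f : sector gamma -> C)
    (c : R) : Prop :=
  0 <= c /\
  (forall j, holomorphic (Deriv_n f j)) /\
  (forall j z, Cmod (Deriv_n f j z) <= c * weight M sigma j).

Lemma Cmod_small_zero (x : C) (w : R) :
  (forall eps : posreal, exists c, c < eps /\ 0 <= c /\ Cmod x <= c * w) ->
  x = 0%C.
Proof.
intros H; apply Cmod_eq_0, Rle_antisym; [|apply Cmod_ge_0].
apply le_epsilon; intros e He.
assert (Hw : 0 < Rabs w + 1) by (pose proof (Rabs_pos w); lra).
destruct (H (mkposreal _ (Rdiv_lt_0_compat _ _ He Hw))) as [c [H1 [H2 H3]]].
simpl in H1.
apply Rle_trans with (c * (Rabs w + 1)).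
- apply Rle_trans with (1 := H3), Rmult_le_compat_l; trivial.
  pose proof (Rle_abs w); lra.
- apply Rmult_lt_compat_r with (r := Rabs w + 1) in H1; trivial.
  replace (e / (Rabs w + 1) * (Rabs w + 1)) with e in H1 by (field; lra); lra.
Qed.

Definition Lambda_gauge (M : nat -> R) (sigma : R) : gauge nat.
Proof.
apply (mkGauge nat (Lambda_adm M sigma)); unfold Lambda_adm.
- tauto.
- split; [lra|]; intros; rewrite Cmod_0; lra.
- intros f g c d [H1 H2] [H3 H4]; split; [lra|]; intros j.
  eapply Rle_trans; [apply Cmod_triangle|].
  specialize (H2 j); specialize (H4 j); lra.
- intros k f c [H1 H2]; split.
  + apply Rmult_le_pos; trivial; apply Cmod_ge_0.
  + intros j; rewrite Cmod_mult, Rmult_assoc.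
    apply Rmult_le_compat_l; auto; apply Cmod_ge_0.
- intros f H j; apply (Cmod_small_zero _ (weight M sigma j)).
  intros e; destruct (H e) as [c [H1 [H2 H3]]]; exists c; auto.
Defined.

Definition Lambda (M : nat -> R) (sigma : R) : Type :=
  gauge_space (Lambda_gauge M sigma).

Lemma punctured_nbhd_proper {gamma : R} (z : sector gamma) :
  ProperFilter' (punctured_nbhd z).
Proof.
destruct z as [z Hz]; unfold punctured_nbhd; simpl.
constructor.
2:{ apply subset_filter_filter, within_filter, locally_filter. }
unfold subset_filter, locally', within; intros [e H].
pose proof (modulus_pos z) as Hr; destruct e as [e He].
assert (Hr' : 0 < modulus z + e / 2) by lra.
apply (H (mkSigma _ (Arg z) Hr')).
- split; simpl.
  + unfold ball; simpl; unfold AbsRing_ball, abs, minus, plus, opp; simpl.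
    replace (modulus z + e / 2 + - modulus z) with (e / 2) by ring.
    rewrite Rabs_pos_eq; lra.
  + apply (ball_center (Arg z) (mkposreal e He)).
- intros E; apply (f_equal modulus) in E; simpl in E; lra.
- exact Hz.
Qed.

Lemma is_Deriv_unique {gamma : R} (f : sector gamma -> C) z l :
  is_Deriv f z l -> Deriv f z = l.
Proof.
intros H; unfold Deriv, is_Deriv.
pose proof (punctured_nbhd_proper z).
exact (iota_filterlim_locally (V := C_CompleteNormedModule) _ l H).
Qed.

Lemma holomorphic_Deriv {gamma : R} (f : sector gamma -> C) :
  holomorphic f -> forall z, is_Deriv f z (Deriv f z).
Proof.
intros H z; destruct (H z) as [l Hl].
now rewrite (is_Deriv_unique f z l Hl).
Qed.

Lemma is_Deriv_zero {gamma : R} (z : sector gamma) :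
  is_Deriv (fun _ => 0%C) z 0%C.
Proof.
unfold is_Deriv; apply (filterlim_ext (fun _ : sector gamma => RtoC 0)).
- intros w; unfold Cdiv; ring.
- pose proof (@filter_filter' _ _ (punctured_nbhd_proper z)).
  apply filterlim_const.
Qed.

Lemma is_Deriv_plus {gamma : R} (f g : sector gamma -> C) z l m :
  is_Deriv f z l -> is_Deriv g z m ->
  is_Deriv (fun w => f w + g w)%C z (l + m)%C.
Proof.
intros Hf Hg; pose proof (@filter_filter' _ _ (punctured_nbhd_proper z)).
unfold is_Deriv; eapply filterlim_ext;
  [|eapply filterlim_comp_2;
    [exact Hf|exact Hg|apply (filterlim_plus (V := C_NormedModule) l m)]].
intros w; unfold plus; simpl; unfold Cdiv; ring.
Qed.

Lemma is_Deriv_scal {gamma : R} k (f : sector gamma -> C) z l :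
  is_Deriv f z l -> is_Deriv (fun w => k * f w)%C z (k * l)%C.
Proof.
intros Hf; pose proof (@filter_filter' _ _ (punctured_nbhd_proper z)).
unfold is_Deriv; eapply filterlim_ext;
  [|eapply filterlim_comp;
    [exact Hf|apply (filterlim_scal_r (V := C_NormedModule) k l)]].
intros w; unfold scal; simpl; unfold mult; simpl; unfold Cdiv; ring.
Qed.

Lemma Deriv_n_zero {gamma : R} n :
  Deriv_n (fun _ : sector gamma => 0%C) n = (fun _ => 0%C).
Proof.
induction n as [|n IH]; trivial; simpl; rewrite IH.
apply functional_extensionality; intros z.
apply is_Deriv_unique, is_Deriv_zero.
Qed.

Lemma Deriv_n_plus {gamma : R} (f g : sector gamma -> C) n :
  (forall j, holomorphic (Deriv_n f j)) ->
  (forall j, holomorphic (Deriv_n g j)) ->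
  Deriv_n (fun w => f w + g w)%C n = (fun w => Deriv_n f n w + Deriv_n g n w)%C.
Proof.
intros Hf Hg; induction n as [|n IH]; trivial; simpl; rewrite IH.
apply functional_extensionality; intros z.
apply is_Deriv_unique, is_Deriv_plus; now apply holomorphic_Deriv.
Qed.

Lemma Deriv_n_scal {gamma : R} k (f : sector gamma -> C) n :
  (forall j, holomorphic (Deriv_n f j)) ->
  Deriv_n (fun w => k * f w)%C n = (fun w => k * Deriv_n f n w)%C.
Proof.
intros Hf; induction n as [|n IH]; trivial; simpl; rewrite IH.
apply functional_extensionality; intros z.
apply is_Deriv_unique, is_Deriv_scal; now apply holomorphic_Deriv.
Qed.

Definition A_gauge (M : nat -> R) (sigma gamma : R) : gauge (sector gamma).
Proof.
apply (mkGauge (sector gamma) (A_adm M sigma gamma)); unfold A_adm.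
- tauto.
- split; [lra|]; split; intros j.
  + rewrite Deriv_n_zero; intros z; exists 0%C; apply is_Deriv_zero.
  + intros z; rewrite Deriv_n_zero, Cmod_0; lra.
- intros f g c d [H1 [H2 H3]] [H4 [H5 H6]]; split; [lra|]; split; intros j.
  + rewrite Deriv_n_plus by trivial; intros z.
    destruct (H2 j z) as [l Hl], (H5 j z) as [m Hm].
    exists (l + m)%C; now apply is_Deriv_plus.
  + intros z; rewrite Deriv_n_plus by trivial.
    eapply Rle_trans; [apply Cmod_triangle|].
    specialize (H3 j z); specialize (H6 j z); lra.
- intros k f c [H1 [H2 H3]]; split.
  { apply Rmult_le_pos; trivial; apply Cmod_ge_0. }
  split; intros j.
  + rewrite Deriv_n_scal by trivial; intros z.
    destruct (H2 j z) as [l Hl]; exists (k * l)%C; now apply is_Deriv_scal.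
  + intros z; rewrite Deriv_n_scal by trivial.
    rewrite Cmod_mult, Rmult_assoc.
    apply Rmult_le_compat_l; auto; apply Cmod_ge_0.
- intros f H z; apply (Cmod_small_zero _ (weight M sigma 0)).
  intros e; destruct (H e) as [c [H1 [H2 [_ H3]]]]; exists c.
  exact (conj H1 (conj H2 (H3 O z))).
Defined.

Definition A_space (M : nat -> R) (sigma gamma : R) : Type :=
  gauge_space (A_gauge M sigma gamma).

(* The graph of the Borel map: B f = lambda. *)
Definition is_Borel {gamma : R} (f : sector gamma -> C) (lambda : nat -> C) :
    Prop :=
  forall j, filterlim (Deriv_n f j) (vertex gamma) (locally (lambda j)).

(* Main.v *)
(* The growth index only enters through one exponent s > gamma with property
   (P_s): it makes M dominate, around each index n, a rescaled Gevrey sequence of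
   order s, up to geometric factors. It therefore suffices to realize each
   monomial z^n / n! in the Gevrey class on S_gamma, and this is done explicitly.
   With x = v^(-1/s), which has positive real part on S_gamma, the function
     Phi_n (v) = v^n (1 - e^(-x) sum_(k < p) x^k / k!),   p = L n >= s n,
   has the Taylor expansion v^n at the vertex, since e^(-x) is flat there, and it
   is small at infinity, since the second factor is O (x^p / p!). Its derivatives
   are explicit combinations of the same kind, which gives
     |Phi_n^(j) (v)| <= B^(n + j + 1) j! (j! / n!)^s   on S_gamma.
   The extension of lambda is sum_n lambda_n / n! tau_n^(-n) Phi_n (tau_n z), where
   tau_n is proportional to sigma and to the scale of M around n. *)
Require Import Defs.
From Stdlib Require Import Reals Arith Lra Lia Factorial Classical FunctionalExtensionality.
From Coquelicot Require Import Coquelicot.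
Open Scope R_scope.

(** * Complex calculus *)

(** Since gamma may exceed 2, functions on S_gamma are read in the coordinate z = log v, on the
    strip |Im z| < gamma PI / 2 of C. There the derivative in v is e^(-z) d/dz, which is why every
    family of successive derivatives below obeys g_j' = e^z g_(j+1). All derivatives of the blocks
    are followed by explicit recursions; Cauchy estimates would need room around the sector. The gap
    gamma < s gives Re x >= delta |x| with delta = cos(gamma PI / (2 s)) > 0, so e^(-x) really
    decays in |x|. The obstacle is that v^n is unbounded on the sector, while the factor that tames
    it must not spoil the ratio j!/n!. Far from the vertex, x is small and the zero of order p of
    the second factor compensates v^n = x^(-s n), because p >= s n. Near the vertex, x is large and
    the decay of e^(-x) does the work. The two regimes meet at |x| = n + 1, where powers of n + 1
    turn into factorials at a geometric cost. Taking p linear in n keeps every constant raised to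
    the power p geometric in n. *)

Definition Cderive (g : C -> C) (z l : C) : Prop :=
  is_derive (K := C_AbsRing) (V := AbsRing_NormedModule C_AbsRing) g z l.

Lemma Cderive_iff (g : C -> C) (z l : C) :
  Cderive g z l <->
  forall eps, 0 < eps -> exists del, 0 < del /\ forall h, Cmod h < del ->
    Cmod (g (z + h) - g z - h * l)%C <= eps * Cmod h.
Proof.
unfold Cderive, is_derive, filterdiff; split.
- intros [_ H] eps He.
  assert (Hz : is_filter_lim (T := AbsRing_UniformSpace C_AbsRing)
    (locally (T := AbsRing_UniformSpace C_AbsRing) z) z) by (intros P HP; exact HP).
  destruct (H z Hz (mkposreal eps He)) as [del Hd]; simpl in Hd.
  exists del; split; [apply cond_pos|]; intros h Hh.
  specialize (Hd (z + h)%C).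
  assert (E : minus (G := C_AbelianGroup) (z + h)%C z = h)
    by (unfold minus, plus, opp; simpl; ring).
  assert (B : ball (M := AbsRing_UniformSpace C_AbsRing) z del (z + h)%C).
  { unfold ball; simpl; unfold AbsRing_ball, abs; simpl.
    change (Cmod (minus (G := C_AbelianGroup) (z + h)%C z) < del); now rewrite E. }
  specialize (Hd B).
  change (Cmod (minus (G := C_AbelianGroup)
     (minus (G := C_AbelianGroup) (g (z + h)%C) (g z))
     (Cmult (minus (G := C_AbelianGroup) (z + h)%C z) l))
     <= eps * Cmod (minus (G := C_AbelianGroup) (z + h)%C z)) in Hd.
  rewrite E in Hd; exact Hd.
- intros H; split; [apply (is_linear_scal_l (K := C_AbsRing))|].
  intros x Hx [eps He]; simpl.
  assert (Ex : z = x).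
  { apply (is_filter_lim_locally_unique (V := AbsRing_NormedModule C_AbsRing)); exact Hx. }
  subst x.
  destruct (H eps He) as [del [Hd Hh]].
  exists (mkposreal del Hd); intros y Hy.
  set (h := minus (G := C_AbelianGroup) y z).
  assert (Ey : y = (z + h)%C).
  { transitivity (z + (y - z))%C; [|reflexivity].
    assert (D : forall u v : C, u = (v + (u - v))%C) by (intros; ring); apply D. }
  change (Cmod h < del) in Hy.
  specialize (Hh h Hy); rewrite <- Ey in Hh; exact Hh.
Qed.

Lemma Cderive_ext (f g : C -> C) (z l m : C) :
  (forall x, f x = g x) -> l = m -> Cderive f z l -> Cderive g z m.
Proof.
intros E <- H; exact (is_derive_ext (K := C_AbsRing) (V := AbsRing_NormedModule C_AbsRing) f g z l E H).
Qed.

Lemma Cderive_const (c z : C) : Cderive (fun _ => c) z 0%C.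
Proof. exact (is_derive_const (K := C_AbsRing) (V := AbsRing_NormedModule C_AbsRing) c z). Qed.

Lemma Cderive_plus (f g : C -> C) (z l m : C) :
  Cderive f z l -> Cderive g z m -> Cderive (fun x => f x + g x)%C z (l + m)%C.
Proof. exact (is_derive_plus (K := C_AbsRing) (V := AbsRing_NormedModule C_AbsRing) f g z l m). Qed.

Lemma Cderive_affine (a b z : C) : Cderive (fun x => a * x + b)%C z a.
Proof.
apply Cderive_iff; intros eps He; exists 1; split; [lra|]; intros h _.
replace (a * (z + h) + b - (a * z + b) - h * a)%C with (RtoC 0) by ring.
rewrite Cmod_0; apply Rmult_le_pos; [lra|apply Cmod_ge_0].
Qed.

Lemma Cderive_mult (f g : C -> C) (z l m : C) :
  Cderive f z l -> Cderive g z m ->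
  Cderive (fun x => f x * g x)%C z (l * g z + f z * m)%C.
Proof.
intros Hf Hg.
exact (is_derive_mult (K := C_AbsRing) f g z l m Hf Hg Cmult_comm).
Qed.

Lemma Cderive_scal (k : C) (f : C -> C) (z l : C) :
  Cderive f z l -> Cderive (fun x => k * f x)%C z (k * l)%C.
Proof.
intros Hf; eapply Cderive_ext; [| |apply (Cderive_mult (fun _ => k) f);
  [apply Cderive_const|exact Hf]]; [reflexivity|simpl; ring].
Qed.

Lemma Cderive_comp (f g : C -> C) (z l m : C) :
  Cderive f (g z) l -> Cderive g z m -> Cderive (fun x => f (g x)) z (m * l)%C.
Proof. exact (is_derive_comp (K := C_AbsRing) (V := AbsRing_NormedModule C_AbsRing) f g z l m). Qed.

Lemma exp_monotone (x y : R) : x <= y -> exp x <= exp y.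
Proof.
intros [H| ->]; [apply Rlt_le, exp_increasing; trivial|lra].
Qed.

(** * The complex exponential and mean value inequalities *)

Definition Cexp (z : C) : C := (exp (fst z) * cos (snd z), exp (fst z) * sin (snd z)).

Lemma Cexp_plus (z w : C) : Cexp (z + w)%C = (Cexp z * Cexp w)%C.
Proof.
unfold Cexp, Cplus, Cmult; simpl.
rewrite exp_plus, cos_plus, sin_plus; f_equal; ring.
Qed.

Lemma Cexp_0 : Cexp 0%C = 1%C.
Proof.
unfold Cexp, RtoC; simpl; rewrite exp_0, cos_0, sin_0; f_equal; ring.
Qed.

Lemma Cmod_Cexp (z : C) : Cmod (Cexp z) = exp (fst z).
Proof.
unfold Cmod, Cexp; simpl.
replace (_ + _) with (Rsqr (exp (fst z))).
- apply sqrt_Rsqr, Rlt_le, exp_pos.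
- pose proof (sin2_cos2 (snd z)) as H; unfold Rsqr in *.
  transitivity (exp (fst z) * exp (fst z) *
    (sin (snd z) * sin (snd z) + cos (snd z) * cos (snd z))); [rewrite H|]; ring.
Qed.

Lemma Cexp_neq_0 (z : C) : Cexp z <> 0%C.
Proof.
apply Cmod_gt_0; rewrite Cmod_Cexp; apply exp_pos.
Qed.

Lemma Cmod_le_plus (z : C) : Cmod z <= Rabs (fst z) + Rabs (snd z).
Proof.
destruct z as [a b]; simpl.
replace (a, b) with (RtoC a + (0, b))%C by (unfold Cplus; simpl; f_equal; ring).
eapply Rle_trans; [apply Cmod_triangle|].
rewrite Cmod_R; apply Rplus_le_compat_l.
unfold Cmod; simpl; replace (0 * (0 * 1) + b * (b * 1)) with (Rsqr b) by (unfold Rsqr; ring).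
rewrite sqrt_Rsqr_abs; lra.
Qed.

Lemma Rabs_fst_le (z : C) : Rabs (fst z) <= Cmod z.
Proof. eapply Rle_trans; [apply Rmax_l|apply Rmax_Cmod]. Qed.

Lemma Rabs_snd_le (z : C) : Rabs (snd z) <= Cmod z.
Proof. eapply Rle_trans; [apply Rmax_r|apply Rmax_Cmod]. Qed.

(** Mean value theorem for b - f. Comparing with a function b instead of a constant slope later
    allows the majorants c t^q and k e^t, where a constant would lose the factorial or the decay. *)
Lemma increment_le (f f' b b' : R -> R) :
  (forall t, 0 <= t <= 1 -> is_derive f t (f' t)) ->
  (forall t, 0 <= t <= 1 -> is_derive b t (b' t)) ->
  (forall t, 0 <= t <= 1 -> f' t <= b' t) ->
  f 1 - f 0 <= b 1 - b 0.
Proof.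
intros Hf Hb H.
destruct (MVT_gen (fun t => b t - f t) 0 1 (fun t => b' t - f' t)) as [c [Hc E]].
- rewrite Rmin_left, Rmax_right by lra; intros x Hx.
  apply (is_derive_minus (K := R_AbsRing) (V := R_NormedModule) b f); [apply Hb|apply Hf]; lra.
- rewrite Rmin_left, Rmax_right by lra; intros x Hx.
  apply continuity_pt_filterlim.
  apply (ex_derive_continuous (K := R_AbsRing) (V := R_NormedModule) (fun t => b t - f t)).
  exists (b' x - f' x).
  apply (is_derive_minus (K := R_AbsRing) (V := R_NormedModule) b f); [apply Hb|apply Hf]; lra.
- rewrite Rmin_left, Rmax_right in Hc by lra.
  specialize (H c Hc); lra.
Qed.

(* Testing against the conjugate of the increment reduces the complex-valued
   mean value inequality to the real one. *)
Lemma Cmod_increment_le (f f' : R -> C) (b b' : R -> R) :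
  (forall t, 0 <= t <= 1 -> is_derive (fun x => fst (f x)) t (fst (f' t))) ->
  (forall t, 0 <= t <= 1 -> is_derive (fun x => snd (f x)) t (snd (f' t))) ->
  (forall t, 0 <= t <= 1 -> is_derive b t (b' t)) ->
  (forall t, 0 <= t <= 1 -> Cmod (f' t) <= b' t) ->
  Cmod (f 1 - f 0)%C <= b 1 - b 0.
Proof.
intros H1 H2 Hb H.
set (c := (f 1 - f 0)%C).
assert (Hb0 : 0 <= b 1 - b 0).
{ apply Rle_trans with (0 - 0); [lra|].
  apply (increment_le (fun _ => 0) (fun _ => 0) b b'); trivial.
  - intros; apply (is_derive_const (K := R_AbsRing) (V := R_NormedModule)).
  - intros t Ht; eapply Rle_trans; [apply Cmod_ge_0|now apply H]. }
destruct (Req_dec (Cmod c) 0) as [E|E]; [rewrite E; lra|].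
assert (Hc : 0 < Cmod c) by (pose proof (Cmod_ge_0 c); lra).
apply Rmult_le_reg_l with (Cmod c); trivial.
set (phi := fun t => fst c * fst (f t) + snd c * snd (f t)).
assert (Ec : Cmod c * Cmod c = phi 1 - phi 0).
{ unfold phi.
  transitivity (Cmod c ^ 2); [ring|]; rewrite Cmod2_alt; unfold Re, Im.
  assert (E1 : fst c = fst (f 1) - fst (f 0)) by reflexivity.
  assert (E2 : snd c = snd (f 1) - snd (f 0)) by reflexivity.
  transitivity (fst c * (fst (f 1) - fst (f 0)) + snd c * (snd (f 1) - snd (f 0))); [|ring].
  rewrite <- E1, <- E2; ring. }
rewrite Ec, Rmult_minus_distr_l.
apply (increment_le phi (fun t => fst c * fst (f' t) + snd c * snd (f' t))
  (fun t => Cmod c * b t) (fun t => Cmod c * b' t)).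
- intros t Ht; apply (is_derive_plus (K := R_AbsRing) (V := R_NormedModule)
    (fun t => fst c * fst (f t)) (fun t => snd c * snd (f t)));
    apply is_derive_scal; auto.
- intros t Ht; apply is_derive_scal; auto.
- intros t Ht; apply Rle_trans with (Cmod c * Cmod (f' t)).
  + rewrite <- (Cmod_conj c), <- Cmod_mult.
    eapply Rle_trans; [|apply re_le_Cmod]; eapply Rle_trans; [|apply Rle_abs].
    unfold Re, Cconj, Cmult; simpl; lra.
  + apply Rmult_le_compat_l; [lra|auto].
Qed.

Lemma Cderive_ray (g : C -> C) (a h l : C) (t : R) :
  Cderive g (a + t * h)%C l ->
  is_derive (fun x : R => fst (g (a + x * h)%C)) t (fst (h * l)%C) /\
  is_derive (fun x : R => snd (g (a + x * h)%C)) t (snd (h * l)%C).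
Proof.
intros H; rewrite Cderive_iff in H.
(* Both components are handled at once, as a real-linear map [p] bounded by the modulus. *)
assert (K : forall p : C -> R, (forall z w, p (z - w)%C = p z - p w) ->
  (forall (r : R) z, p (r * z)%C = r * p z) ->
  (forall z, Rabs (p z) <= Cmod z) ->
  is_derive (fun x : R => p (g (a + x * h)%C)) t (p (h * l)%C)).
{ intros p P1 P2 P3; apply is_derive_Reals; intros eps He.
  assert (Hm : 0 < Cmod h + 1) by (pose proof (Cmod_ge_0 h); lra).
  (* The summand 1 keeps the division legal when h = 0; the half yields the strict inequality
     required by the real derivative. *)
  destruct (H (eps / 2 / (Cmod h + 1))) as [del [Hd Hh]].
  { apply Rdiv_lt_0_compat; lra. }
  assert (Hd' : 0 < del / (Cmod h + 1)) by (apply Rdiv_lt_0_compat; lra).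
  exists (mkposreal _ Hd'); simpl; intros r Hr0 Hr.
  assert (Hrp : 0 < Rabs r) by (now apply Rabs_pos_lt).
  assert (Hrh : Cmod (r * h)%C = Rabs r * Cmod h) by (rewrite Cmod_mult, Cmod_R; ring).
  assert (Hlt : Rabs r * (Cmod h + 1) < del).
  { apply Rmult_lt_compat_r with (r := Cmod h + 1) in Hr; trivial.
    replace (del / (Cmod h + 1) * (Cmod h + 1)) with del in Hr by (field; lra); lra. }
  assert (Hs : Cmod (r * h)%C < del).
  { rewrite Hrh; lra. }
  specialize (Hh _ Hs).
  replace (a + t * h + r * h)%C with (a + RtoC (t + r) * h)%C in Hh
    by (rewrite RtoC_plus; ring).
  replace (r * h * l)%C with (r * (h * l))%C in Hh by ring.
  apply (Rle_trans _ _ _ (P3 _)) in Hh.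
  rewrite !P1, P2, Hrh in Hh.
  set (u := p (g (a + RtoC (t + r) * h)%C) - p (g (a + t * h)%C)) in *.
  replace (u / r - p (h * l)%C) with ((u - r * p (h * l)%C) / r) by (field; trivial).
  unfold Rdiv at 1; rewrite Rabs_mult, Rabs_inv.
  apply Rmult_lt_reg_r with (Rabs r); trivial.
  rewrite Rmult_assoc, Rinv_l, Rmult_1_r by lra.
  eapply Rle_lt_trans; [exact Hh|].
  replace (eps / 2 / (Cmod h + 1) * (Rabs r * Cmod h)) with
    ((eps / 2 * Rabs r) * (Cmod h / (Cmod h + 1))) by (field; lra).
  assert (Cmod h / (Cmod h + 1) <= 1).
  { apply Rmult_le_reg_r with (Cmod h + 1); trivial.
    replace (Cmod h / (Cmod h + 1) * (Cmod h + 1)) with (Cmod h) by (field; lra); lra. }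
  assert (0 < eps / 2 * Rabs r) by (apply Rmult_lt_0_compat; lra).
  apply Rle_lt_trans with (eps / 2 * Rabs r * 1); [apply Rmult_le_compat_l; lra|lra]. }
split.
- apply (K fst); [reflexivity| |apply Rabs_fst_le].
  intros r z; unfold Cmult, RtoC; simpl; ring.
- apply (K snd); [reflexivity| |apply Rabs_snd_le].
  intros r z; unfold Cmult, RtoC; simpl; ring.
Qed.

Lemma Cderive_increment_le (g g' : C -> C) (a h : C) (b b' : R -> R) :
  (forall t, 0 <= t <= 1 -> Cderive g (a + t * h)%C (g' (a + t * h)%C)) ->
  (forall t, 0 <= t <= 1 -> is_derive b t (b' t)) ->
  (forall t, 0 <= t <= 1 -> Cmod (h * g' (a + RtoC t * h))%C <= b' t) ->
  Cmod (g (a + h) - g a)%C <= b 1 - b 0.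
Proof.
intros H Hb Hle.
replace (g (a + h) - g a)%C with (g (a + RtoC 1 * h) - g (a + RtoC 0 * h))%C
  by (f_equal; [|f_equal]; f_equal; ring).
apply (Cmod_increment_le (fun t : R => g (a + t * h)%C)
  (fun t : R => (h * g' (a + t * h))%C) b b'); trivial;
  intros t Ht; apply (Cderive_ray g a h (g' (a + t * h)%C) t (H t Ht)).
Qed.

Lemma Cderive_lipschitz (g g' : C -> C) (a h : C) (K : R) :
  (forall t, 0 <= t <= 1 -> Cderive g (a + t * h)%C (g' (a + t * h)%C)) ->
  (forall t, 0 <= t <= 1 -> Cmod (g' (a + RtoC t * h))%C <= K) ->
  Cmod (g (a + h) - g a)%C <= K * Cmod h.
Proof.
intros H Hle.
replace (K * Cmod h) with ((K * Cmod h) * 1 - (K * Cmod h) * 0) by ring.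
apply (Cderive_increment_le g g' a h (fun t => (K * Cmod h) * t) (fun _ => K * Cmod h)); trivial.
- intros t _; auto_derive; [trivial|ring].
- intros t Ht; rewrite Cmod_mult, Rmult_comm.
  apply Rmult_le_compat_r; [apply Cmod_ge_0|auto].
Qed.

Lemma Cderive_taylor2 (g g' g'' : C -> C) (a h : C) (K : R) :
  (forall t, 0 <= t <= 1 -> Cderive g (a + t * h)%C (g' (a + t * h)%C)) ->
  (forall t, 0 <= t <= 1 -> Cderive g' (a + t * h)%C (g'' (a + t * h)%C)) ->
  (forall t, 0 <= t <= 1 -> Cmod (g'' (a + RtoC t * h))%C <= K) ->
  Cmod (g (a + h) - g a - h * g' a)%C <= K * Cmod h ^ 2.
Proof.
intros H H' Hle.
assert (HK : 0 <= K).
{ eapply Rle_trans; [apply Cmod_ge_0|apply (Hle 0); lra]. }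
replace (g (a + h) - g a - h * g' a)%C with
  ((g (a + h) + (- g' a * (a + h) + g' a * a)) - (g a + (- g' a * a + g' a * a)))%C by ring.
replace (K * Cmod h ^ 2) with ((K * Cmod h) * Cmod h) by ring.
(* With the tangent at a subtracted, the derivative is g' - g'(a), which is itself controlled by the
   Lipschitz bound for g'. *)
apply (Cderive_lipschitz (fun z => g z + (- g' a * z + g' a * a))%C
  (fun z => g' z + - g' a)%C).
- intros t Ht; apply Cderive_plus; [auto|apply Cderive_affine].
- intros t Ht.
  replace (a + t * h)%C with (a + (t * h))%C by ring.
  apply Rle_trans with (K * Cmod (t * h)%C).
  + apply (Cderive_lipschitz g' g'').
    * intros x Hx; replace (x * (t * h))%C with (RtoC (x * t) * h)%C
        by (rewrite RtoC_mult; ring).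
      apply H'; nra.
    * intros x Hx; replace (x * (t * h))%C with (RtoC (x * t) * h)%C
        by (rewrite RtoC_mult; ring).
      apply Hle; nra.
  + rewrite Cmod_mult, Cmod_R, Rabs_pos_eq by lra.
    pose proof (Cmod_ge_0 h).
    apply Rmult_le_compat_l; trivial; nra.
Qed.

(** Computed on real and imaginary parts, because the complex derivative of [Cexp] is deduced from
    the bounds that rest on this lemma. *)
Lemma Cexp_ray (h : C) (t : R) :
  is_derive (fun x : R => fst (Cexp (x * h)%C)) t (fst (h * Cexp (t * h))%C) /\
  is_derive (fun x : R => snd (Cexp (x * h)%C)) t (snd (h * Cexp (t * h))%C).
Proof.
destruct h as [a b]; unfold Cexp, Cmult; simpl; split; auto_derive; trivial;
  unfold Rminus; ring.
Qed.

Lemma Cexp_sub_1_bound (h : C) : Cmod h <= 1 -> Cmod (Cexp h - 1)%C <= exp 1 * Cmod h.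
Proof.
intros Hh; pose proof (Cmod_ge_0 h) as H0.
replace (Cexp h - 1)%C with (Cexp (RtoC 1 * h) - Cexp (RtoC 0 * h))%C
  by (rewrite Cmult_1_l, Cmult_0_l, Cexp_0; reflexivity).
replace (exp 1 * Cmod h) with ((exp 1 * Cmod h) * 1 - (exp 1 * Cmod h) * 0) by ring.
apply (Cmod_increment_le (fun t : R => Cexp (t * h)%C) (fun t : R => (h * Cexp (t * h))%C)
  (fun t => (exp 1 * Cmod h) * t) (fun _ => exp 1 * Cmod h));
  try (intros t _; apply Cexp_ray).
- intros t _; auto_derive; [trivial|ring].
- intros t Ht; rewrite Cmod_mult, Rmult_comm, Cmod_Cexp.
  apply Rmult_le_compat_r; trivial.
  apply exp_monotone; simpl.
  pose proof (Rle_trans _ _ _ (Rle_abs _) (Rabs_fst_le h)); nra.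
Qed.

Lemma Cexp_taylor_bound (h : C) :
  Cmod h <= 1 -> Cmod (Cexp h - 1 - h)%C <= exp 1 * Cmod h ^ 2.
Proof.
intros Hh; pose proof (Cmod_ge_0 h) as H0.
replace (Cexp h - 1 - h)%C with
  ((Cexp (RtoC 1 * h) - RtoC 1 * h) - (Cexp (RtoC 0 * h) - RtoC 0 * h))%C
  by (rewrite !Cmult_1_l, !Cmult_0_l, Cexp_0; ring).
replace (exp 1 * Cmod h ^ 2) with
  ((exp 1 * Cmod h ^ 2) * 1 - (exp 1 * Cmod h ^ 2) * 0) by ring.
apply (Cmod_increment_le (fun t : R => (Cexp (t * h) - t * h)%C)
  (fun t : R => (h * Cexp (t * h) - h)%C)
  (fun t => (exp 1 * Cmod h ^ 2) * t) (fun _ => exp 1 * Cmod h ^ 2)).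
- intros t _; apply (is_derive_minus (K := R_AbsRing) (V := R_NormedModule)
    (fun x => fst (Cexp (x * h)%C)) (fun x => fst (x * h)%C)); [apply Cexp_ray|].
  unfold Cmult; simpl; auto_derive; [trivial|ring].
- intros t _; apply (is_derive_minus (K := R_AbsRing) (V := R_NormedModule)
    (fun x => snd (Cexp (x * h)%C)) (fun x => snd (x * h)%C)); [apply Cexp_ray|].
  unfold Cmult; simpl; auto_derive; [trivial|ring].
- intros t _; auto_derive; [trivial|ring].
- intros t Ht; replace (h * Cexp (t * h) - h)%C with (h * (Cexp (t * h) - 1))%C by ring.
  rewrite Cmod_mult.
  assert (Et : Cmod (t * h)%C = t * Cmod h) by (rewrite Cmod_mult, Cmod_R, Rabs_pos_eq; lra).
  assert (Cmod (Cexp (t * h) - 1)%C <= exp 1 * Cmod h).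
  { eapply Rle_trans; [apply Cexp_sub_1_bound; rewrite Et; nra|].
    rewrite Et; apply Rmult_le_compat_l; [apply Rlt_le, exp_pos|nra]. }
  replace (exp 1 * Cmod h ^ 2) with (Cmod h * (exp 1 * Cmod h)) by ring.
  now apply Rmult_le_compat_l.
Qed.

(** A quadratic remainder on a fixed ball is a bound that can be summed over a series, unlike the
    eps-delta form of the derivative. *)
Lemma Cderive_of_quadratic (g : C -> C) (z l : C) (K r : R) :
  0 < r ->
  (forall h, Cmod h < r -> Cmod (g (z + h) - g z - h * l)%C <= K * Cmod h ^ 2) ->
  Cderive g z l.
Proof.
intros Hr H; apply Cderive_iff; intros eps He.
assert (HK : 0 < Rabs K + 1) by (pose proof (Rabs_pos K); lra).
exists (Rmin r (eps / (Rabs K + 1))); split.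
{ apply Rmin_glb_lt; trivial; now apply Rdiv_lt_0_compat. }
intros h Hh.
assert (H1 := Rlt_le_trans _ _ _ Hh (Rmin_l _ _)).
assert (H2 := Rlt_le_trans _ _ _ Hh (Rmin_r _ _)).
apply (Rle_trans _ _ _ (H h H1)).
pose proof (Cmod_ge_0 h); pose proof (Rle_abs K).
replace (K * Cmod h ^ 2) with ((K * Cmod h) * Cmod h) by ring.
apply Rmult_le_compat_r; trivial.
apply Rmult_lt_compat_l with (r := Rabs K + 1) in H2; trivial.
replace ((Rabs K + 1) * (eps / (Rabs K + 1))) with eps in H2 by (field; lra); nra.
Qed.

Lemma Cderive_Cexp (z : C) : Cderive Cexp z (Cexp z).
Proof.
apply (Cderive_of_quadratic _ _ _ (Cmod (Cexp z) * exp 1) 1); [lra|]; intros h Hh.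
replace (Cexp (z + h) - Cexp z - h * Cexp z)%C with (Cexp z * (Cexp h - 1 - h))%C
  by (rewrite Cexp_plus; ring).
rewrite Cmod_mult, Rmult_assoc; apply Rmult_le_compat_l; [apply Cmod_ge_0|].
apply Cexp_taylor_bound; lra.
Qed.

Lemma Cderive_Cexp_affine (a b z : C) :
  Cderive (fun x => Cexp (a * x + b))%C z (a * Cexp (a * z + b))%C.
Proof.
apply (Cderive_comp Cexp (fun x => a * x + b)%C); [apply Cderive_Cexp|apply Cderive_affine].
Qed.

(** * Termwise derivation *)

(** [Series] is total and returns a default value on divergent series, so the algebraic rules below
    carry a [geom_bounded] hypothesis. *)
Definition Csum (a : nat -> C) : C :=
  (Series (fun n => fst (a n)), Series (fun n => snd (a n))).

(** The ratio is fixed at 1/2, the one that the rescaling factors of the extension operator leave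
    over; only the constant K varies. *)
Definition geom_bounded (a : nat -> C) (K : R) : Prop :=
  forall n, Cmod (a n) <= K * (/ 2) ^ n.

Lemma Series_geom_half (K : R) : Series (fun n => K * (/ 2) ^ n) = 2 * K.
Proof.
rewrite Series_scal_l, Series_geom by (rewrite Rabs_pos_eq; lra); field.
Qed.

Lemma ex_series_geom_half (K : R) : ex_series (fun n => K * (/ 2) ^ n).
Proof.
apply (ex_series_scal (V := R_NormedModule) K), ex_series_geom.
rewrite Rabs_pos_eq; lra.
Qed.

Lemma Series_geom_bounded (a : nat -> R) (K : R) :
  (forall n, Rabs (a n) <= K * (/ 2) ^ n) -> ex_series a /\ Rabs (Series a) <= 2 * K.
Proof.
intros H.
assert (Ha : ex_series (fun n => Rabs (a n))).
{ apply (ex_series_le (K := R_AbsRing) (V := R_CompleteNormedModule) _ (fun n => K * (/ 2) ^ n));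
    [|apply ex_series_geom_half].
  intros n; change (Rabs (Rabs (a n)) <= K * (/ 2) ^ n); now rewrite Rabs_Rabsolu. }
split; [now apply ex_series_Rabs|].
eapply Rle_trans; [now apply Series_Rabs|].
rewrite <- Series_geom_half; apply Series_le; [|apply ex_series_geom_half].
intros n; split; [apply Rabs_pos|apply H].
Qed.

Lemma geom_bounded_series (a : nat -> C) (K : R) :
  geom_bounded a K ->
  (ex_series (fun n => fst (a n)) /\ ex_series (fun n => snd (a n))) /\
  Cmod (Csum a) <= 4 * K.
Proof.
intros H.
destruct (Series_geom_bounded (fun n => fst (a n)) K) as [E1 B1].
{ intros n; exact (Rle_trans _ _ _ (Rabs_fst_le _) (H n)). }
destruct (Series_geom_bounded (fun n => snd (a n)) K) as [E2 B2].
{ intros n; exact (Rle_trans _ _ _ (Rabs_snd_le _) (H n)). }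
repeat split; trivial.
eapply Rle_trans; [apply Cmod_le_plus|]; simpl; lra.
Qed.

Lemma Csum_plus (a b : nat -> C) (K L : R) :
  geom_bounded a K -> geom_bounded b L ->
  Csum (fun n => a n + b n)%C = (Csum a + Csum b)%C.
Proof.
intros Ha Hb.
destruct (geom_bounded_series a K Ha) as [[? ?] _], (geom_bounded_series b L Hb) as [[? ?] _].
unfold Csum, Cplus; simpl; now rewrite !Series_plus.
Qed.

Lemma Csum_scal (k : C) (a : nat -> C) (K : R) :
  geom_bounded a K -> Csum (fun n => k * a n)%C = (k * Csum a)%C.
Proof.
intros Ha; destruct (geom_bounded_series a K Ha) as [[? ?] _].
destruct k as [x y]; unfold Csum, Cmult; simpl.
rewrite Series_minus, Series_plus, !Series_scal_l; trivial;
  apply (ex_series_scal (V := R_NormedModule)); trivial.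
Qed.

Lemma Csum_ext (a b : nat -> C) : (forall n, a n = b n) -> Csum a = Csum b.
Proof.
intros H; unfold Csum; f_equal; apply Series_ext; intros n; now rewrite H.
Qed.

Lemma geom_bounded_plus (a b : nat -> C) (K L : R) :
  geom_bounded a K -> geom_bounded b L -> geom_bounded (fun n => a n + b n)%C (K + L).
Proof.
intros Ha Hb n; eapply Rle_trans; [apply Cmod_triangle|].
specialize (Ha n); specialize (Hb n); lra.
Qed.

Lemma geom_bounded_scal (k : C) (a : nat -> C) (K : R) :
  geom_bounded a K -> geom_bounded (fun n => k * a n)%C (Cmod k * K).
Proof.
intros Ha n; rewrite Cmod_mult, Rmult_assoc.
apply Rmult_le_compat_l; [apply Cmod_ge_0|apply Ha].
Qed.

Lemma Csum_single (k : C) (j : nat) :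
  Csum (fun n => if Nat.eqb n j then k else 0%C) = k.
Proof.
assert (S : forall x : R, Series (fun n => if Nat.eqb n j then x else 0) = x).
{ intros x; apply is_series_unique.
  apply is_series_Reals; intros eps He; exists j; intros n Hn.
  replace (sum_f_R0 _ n) with x; [unfold Rdist; rewrite Rminus_diag, Rabs_R0; lra|].
  revert Hn; induction n as [|n IH]; intros Hn.
  - assert (j = 0)%nat by lia; subst j; reflexivity.
  - rewrite tech5; destruct (Nat.eqb_spec (S n) j) as [E|E].
    + rewrite sum_eq_R0; [ring|]; intros i Hi.
      destruct (Nat.eqb_spec i j); [lia|trivial].
    + rewrite <- IH by lia; ring. }
destruct k as [x y]; unfold Csum; f_equal.
- etransitivity; [|apply (S x)]; apply Series_ext; intros n; now destruct Nat.eqb.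
- etransitivity; [|apply (S y)]; apply Series_ext; intros n; now destruct Nat.eqb.
Qed.

Section TermwiseDerivation.

Context (width : R) (u : nat -> nat -> C -> C) (K : nat -> R)
  (u_derive : forall n j z, Rabs (snd z) < width ->
     Cderive (u n j) z (Cexp z * u n (S j) z)%C)
  (u_bound : forall j z, Rabs (snd z) < width ->
     geom_bounded (fun n => u n j z) (K j)).

(** Second-order Taylor remainders of the terms are bounded by a multiple of 2^(-n) |h|^2, uniformly
    in n, and then summed. The bounds for j + 1 and j + 2 provide the second derivatives. *)
Lemma Cderive_Csum (j : nat) (z : C) :
  Rabs (snd z) < width ->
  Cderive (fun w => Csum (fun n => u n j w)) z (Cexp z * Csum (fun n => u n (S j) z))%C.
Proof.
intros Hz.
set (r := Rmin 1 (width - Rabs (snd z))).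
assert (Hr : 0 < r) by (apply Rmin_glb_lt; lra).
assert (Hr1 : r <= 1) by apply Rmin_l.
assert (Hrw : r <= width - Rabs (snd z)) by apply Rmin_r.
assert (Hseg : forall h t, Cmod h < r -> 0 <= t <= 1 ->
  Rabs (snd (z + t * h)%C) < width /\ Cmod (Cexp (z + t * h)) <= exp (fst z + 1)).
{ intros h t Hh Ht; rewrite Cmod_Cexp.
  pose proof (Rabs_fst_le h) as H1; pose proof (Rabs_snd_le h) as H2.
  pose proof (Rle_abs (fst h)) as H3; split.
  - replace (snd (z + t * h)%C) with (snd z + t * snd h) by (simpl; ring).
    eapply Rle_lt_trans; [apply Rabs_triang|].
    rewrite Rabs_mult, (Rabs_pos_eq t) by lra.
    pose proof (Rabs_pos (snd h)); nra.
  - apply exp_monotone; simpl; nra. }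
set (e := exp (fst z + 1)) in *.
assert (He : 0 <= e) by (apply Rlt_le, exp_pos).
(* The second derivative in z of the j-th member is e^z u_(j+1) + e^(2z) u_(j+2), and [e] bounds
   |e^w| on the ball of radius r <= 1. *)
set (K2 := e * K (S j) + e * (e * K (S (S j)))).
apply (Cderive_of_quadratic _ _ _ (4 * K2) r Hr); intros h Hh.
assert (Hw : Rabs (snd (z + h)%C) < width).
{ replace h with (1 * h)%C by ring; apply (Hseg h 1 Hh); lra. }
set (d := fun n => (u n j (z + h) + (- (1)) * u n j z + (- (h * Cexp z)) * u n (S j) z)%C).
assert (Hd : geom_bounded d (K2 * Cmod h ^ 2)).
{ intros n; unfold d.
  replace (u n j (z + h) + - (1) * u n j z + - (h * Cexp z) * u n (S j) z)%C
    with (u n j (z + h) - u n j z - h * (Cexp z * u n (S j) z))%C by ring.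
  replace (K2 * Cmod h ^ 2 * (/ 2) ^ n) with (K2 * (/ 2) ^ n * Cmod h ^ 2) by ring.
  apply (Cderive_taylor2 (u n j) (fun w => Cexp w * u n (S j) w)%C
    (fun w => Cexp w * u n (S j) w + Cexp w * (Cexp w * u n (S (S j)) w))%C).
  - intros t Ht; apply u_derive; now apply Hseg.
  - intros t Ht; apply Cderive_mult; [apply Cderive_Cexp|].
    apply u_derive; now apply Hseg.
  - intros t Ht; destruct (Hseg h t Hh Ht) as [H1 H2].
    pose proof (u_bound (S j) _ H1 n) as B1; pose proof (u_bound (S (S j)) _ H1 n) as B2.
    simpl in B1, B2.
    set (w := (z + t * h)%C) in *.
    eapply Rle_trans; [apply Cmod_triangle|]; rewrite !Cmod_mult; unfold K2.
    replace ((e * K (S j) + e * (e * K (S (S j)))) * (/ 2) ^ n) with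
      (e * (K (S j) * (/ 2) ^ n) + e * (e * (K (S (S j)) * (/ 2) ^ n))) by ring.
    apply Rplus_le_compat; repeat apply Rmult_le_compat; trivial;
      try apply Cmod_ge_0; apply Rmult_le_pos; apply Cmod_ge_0. }
assert (E : Csum d = (Csum (fun n => u n j (z + h)) - Csum (fun n => u n j z)
    - h * (Cexp z * Csum (fun n => u n (S j) z)))%C).
{ unfold d.
  pose proof (u_bound j _ Hz) as B0; pose proof (u_bound j _ Hw) as B1.
  pose proof (u_bound (S j) _ Hz) as B2.
  rewrite (Csum_plus _ _ _ _ (geom_bounded_plus _ _ _ _ B1 (geom_bounded_scal (- (1))%C _ _ B0))
    (geom_bounded_scal (- (h * Cexp z))%C _ _ B2)).
  rewrite (Csum_plus _ _ _ _ B1 (geom_bounded_scal (- (1))%C _ _ B0)).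
  rewrite (Csum_scal _ _ _ B0), (Csum_scal _ _ _ B2); ring. }
rewrite <- E.
destruct (geom_bounded_series d _ Hd) as [_ B]; lra.
Qed.

End TermwiseDerivation.

(** * Logarithmic chart *)

Definition logz (z : Sigma) : C := (ln (modulus z), Arg z).

Lemma proj_Cexp (z : Sigma) : proj z = Cexp (logz z).
Proof.
unfold proj, Cexp, logz; simpl; now rewrite exp_ln by apply modulus_pos.
Qed.

Lemma logz_inj (z w : Sigma) : logz z = logz w -> z = w.
Proof.
destruct z as [r a Hr], w as [r' a' Hr']; unfold logz; simpl; intros E; injection E as E1 E2.
apply ln_inv in E1; trivial; subst r' a'; f_equal; apply ProofIrrelevance.proof_irrelevance.
Qed.

Lemma logz_continuous (z : Sigma) (eps : R) :
  0 < eps -> locally z (fun w => Cmod (logz w - logz z)%C < eps).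
Proof.
intros He.
assert (Hc : continuous (U := R_UniformSpace) ln (modulus z)).
{ apply continuity_pt_filterlim, derivable_continuous_pt.
  exists (/ modulus z); apply derivable_pt_lim_ln, modulus_pos. }
assert (He2 : 0 < eps / 2) by lra.
destruct (proj1 (filterlim_locally ln (ln (modulus z))) Hc (mkposreal _ He2)) as [d Hd].
assert (Hm : 0 < Rmin d (eps / 2)) by (apply Rmin_glb_lt; [apply cond_pos|trivial]).
exists (mkposreal _ Hm); intros w [H1 H2]; simpl in H1, H2.
specialize (Hd (modulus w)).
assert (B : ball (modulus z) d (modulus w)).
{ apply Rlt_le_trans with (Rmin d (eps / 2)); [exact H1|apply Rmin_l]. }
specialize (Hd B); change (Rabs (ln (modulus w) - ln (modulus z)) < eps / 2) in Hd.
change (Rabs (Arg w - Arg z) < Rmin d (eps / 2)) in H2.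
pose proof (Rmin_r d (eps / 2)).
eapply Rle_lt_trans; [apply Cmod_le_plus|]; simpl.
fold (Rminus (ln (modulus w)) (ln (modulus z))) (Rminus (Arg w) (Arg z)); lra.
Qed.

Lemma C_locally_Cmod (l : C) (P : C -> Prop) :
  locally l P -> exists eps, 0 < eps /\ forall y, Cmod (y - l)%C < eps -> P y.
Proof.
intros [eps H]; exists eps; split; [apply cond_pos|]; intros y Hy.
apply H; split.
- exact (Rle_lt_trans _ _ _ (Rabs_fst_le (y - l)%C) Hy).
- exact (Rle_lt_trans _ _ _ (Rabs_snd_le (y - l)%C) Hy).
Qed.

(** The difference quotient in v is the quotient of two increments in z, that of g and that of e^z;
    both are expanded to first order at the same point. *)
Lemma is_Deriv_chart (gamma : R) (g : C -> C) (z : sector gamma) (l : C) :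
  Cderive g (logz (proj1_sig z)) (Cexp (logz (proj1_sig z)) * l)%C ->
  is_Deriv (fun w : sector gamma => g (logz (proj1_sig w))) z l.
Proof.
destruct z as [z Hz]; cbn [proj1_sig]; intros Hg.
unfold is_Deriv; intros P HP.
destruct (C_locally_Cmod l P HP) as [eps [He HeP]].
unfold filtermap, punctured_nbhd, subset_filter, locally', within; cbn [proj1_sig].
set (a := logz z) in *; set (E := Cexp a) in *.
assert (HE : 0 < Cmod E) by (apply Cmod_gt_0, Cexp_neq_0).
pose proof (Cmod_ge_0 l) as Hl.
rewrite Cderive_iff in Hg.
(* The first bound keeps the increment q of e^z above |h| |E| / 2, hence nonzero; the second brings
   the total error eta (1 + |l|) |h| below eps |q|. *)
set (eta := Rmin (Cmod E / 2) (eps * Cmod E / (4 * (1 + Cmod l)))).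
assert (Heta : 0 < eta).
{ apply Rmin_glb_lt; [lra|]; apply Rdiv_lt_0_compat; [|lra]; now apply Rmult_lt_0_compat. }
assert (Heta1 : eta <= Cmod E / 2) by apply Rmin_l.
assert (Heta2 : eta * (4 * (1 + Cmod l)) <= eps * Cmod E).
{ apply Rle_trans with (eps * Cmod E / (4 * (1 + Cmod l)) * (4 * (1 + Cmod l))).
  - apply Rmult_le_compat_r; [lra|apply Rmin_r].
  - right; field; lra. }
destruct (Hg eta Heta) as [d1 [Hd1 H1]].
pose proof (Cderive_Cexp a) as Hexp; fold E in Hexp; rewrite Cderive_iff in Hexp.
destruct (Hexp eta Heta) as [d2 [Hd2 H2]].
generalize (logz_continuous z (Rmin d1 d2) (Rmin_glb_lt _ _ _ Hd1 Hd2)).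
apply filter_imp; intros w Hw Hne Hs; apply HeP; rewrite !proj_Cexp; fold a.
set (h := (logz w - a)%C) in *.
replace (logz w) with (a + h)%C by (unfold h; ring).
assert (Hh : 0 < Cmod h).
{ apply Cmod_gt_0; intros E0; apply Hne, logz_inj; fold a.
  replace (logz w) with (a + h)%C by (unfold h; ring); rewrite E0; ring. }
specialize (H1 h (Rlt_le_trans _ _ _ Hw (Rmin_l _ _))).
specialize (H2 h (Rlt_le_trans _ _ _ Hw (Rmin_r _ _))).
set (q := (Cexp (a + h) - Cexp a)%C) in *; fold E in q, H2.
assert (Hq : Cmod h * (Cmod E / 2) <= Cmod q).
{ assert (T : Cmod (h * E)%C <= Cmod q + Cmod (q - h * E)%C).
  { replace (h * E)%C with (q + - (q - h * E))%C at 1 by ring.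
    eapply Rle_trans; [apply Cmod_triangle|]; rewrite Cmod_opp; lra. }
  rewrite Cmod_mult in T; nra. }
assert (Hq0 : 0 < Cmod q) by nra.
assert (Hqn : q <> 0%C) by now apply Cmod_gt_0.
replace ((g (a + h) - g a) / q - l)%C with ((g (a + h) - g a - q * l) / q)%C by (field; trivial).
rewrite Cmod_div by trivial.
apply Rmult_lt_reg_r with (Cmod q); trivial.
unfold Rdiv; rewrite Rmult_assoc, Rinv_l, Rmult_1_r by lra.
replace (g (a + h) - g a - q * l)%C with
  ((g (a + h) - g a - h * (E * l)) + - ((q - h * E) * l))%C by ring.
eapply Rle_lt_trans; [apply Cmod_triangle|]; rewrite Cmod_opp, Cmod_mult.
assert (Cmod (q - h * E)%C * Cmod l <= eta * Cmod h * Cmod l)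
  by (apply Rmult_le_compat_r; trivial).
apply Rle_lt_trans with (eta * (1 + Cmod l) * Cmod h); [lra|].
apply Rlt_le_trans with (eps * Cmod E / 2 * Cmod h).
- apply Rmult_lt_compat_r; trivial.
  assert (0 < eps * Cmod E) by (now apply Rmult_lt_0_compat); lra.
- apply Rle_trans with (eps * (Cmod h * (Cmod E / 2))); [lra|].
  apply Rmult_le_compat_l; lra.
Qed.

(** The candidates for all derivatives are given in advance, so uniqueness of the derivative
    evaluates the iterated [iota] behind [Deriv_n]. *)
Lemma Deriv_n_chart (gamma : R) (f : nat -> C -> C) :
  (forall j z, Rabs (snd z) < gamma * PI / 2 ->
     Cderive (f j) z (Cexp z * f (S j) z)%C) ->
  forall j,
    Deriv_n (fun w : sector gamma => f O (logz (proj1_sig w))) j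
    = (fun w => f j (logz (proj1_sig w))).
Proof.
intros H; induction j as [|j IH]; trivial; simpl; rewrite IH.
apply functional_extensionality; intros z; apply is_Deriv_unique, is_Deriv_chart, H.
exact (proj2_sig z).
Qed.

Lemma holomorphic_chart (gamma : R) (f : nat -> C -> C) :
  (forall j z, Rabs (snd z) < gamma * PI / 2 ->
     Cderive (f j) z (Cexp z * f (S j) z)%C) ->
  forall j, holomorphic (Deriv_n (fun w : sector gamma => f O (logz (proj1_sig w))) j).
Proof.
intros H j; rewrite (Deriv_n_chart gamma f H); intros z.
exists (f (S j) (logz (proj1_sig z))); apply is_Deriv_chart, H, (proj2_sig z).
Qed.

(** * Finite complex sums *)

Fixpoint psum (f : nat -> C) (m : nat) : C :=
  match m with O => 0%C | S m => (psum f m + f m)%C end.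

Lemma psum_split_first (f : nat -> C) (m : nat) :
  psum f (S m) = (f O + psum (fun i => f (S i)) m)%C.
Proof.
induction m as [|m IH]; [simpl; ring|].
change (psum f (S (S m))) with (psum f (S m) + f (S m))%C; rewrite IH; simpl; ring.
Qed.

Lemma psum_ext (f g : nat -> C) (m : nat) :
  (forall i, (i < m)%nat -> f i = g i) -> psum f m = psum g m.
Proof.
intros H; induction m as [|m IH]; trivial; simpl; rewrite IH, H; trivial; [lia|].
intros i Hi; apply H; lia.
Qed.

Lemma psum_plus (f g : nat -> C) (m : nat) :
  psum (fun i => f i + g i)%C m = (psum f m + psum g m)%C.
Proof. induction m as [|m IH]; simpl; [|rewrite IH]; ring. Qed.

Lemma psum_scal (k : C) (f : nat -> C) (m : nat) :
  psum (fun i => k * f i)%C m = (k * psum f m)%C.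
Proof. induction m as [|m IH]; simpl; [|rewrite IH]; ring. Qed.

Lemma Cderive_psum (f : nat -> C -> C) (f' : nat -> C) (z : C) (m : nat) :
  (forall i, Cderive (f i) z (f' i)) ->
  Cderive (fun w => psum (fun i => f i w) m) z (psum f' m).
Proof.
intros H; induction m as [|m IH]; simpl; [apply Cderive_const|now apply Cderive_plus].
Qed.

(** * Gevrey building blocks *)

Section Blocks.

Context (s : R) (n p : nat).

(* With x = Cexp (- z / s), [xpow k z] is x ^ k and [xexp k z] is x ^ k e ^ (- x). *)
Definition xpow (k : nat) (z : C) : C := Cexp (RtoC (- (INR k / s)) * z)%C.

Definition xexp (k : nat) (z : C) : C := (xpow k z * Cexp (- xpow 1 z))%C.

(* 1 - e ^ (- x) * sum_(k < q) x ^ k / k! *)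
Fixpoint Theta (q : nat) (z : C) : C :=
  match q with
  | O => 1%C
  | S q => (Theta q z - RtoC (/ INR (fact q)) * xexp q z)%C
  end.

Fixpoint falling (j : nat) : R :=
  match j with O => 1 | S j => (INR n - INR j) * falling j end.

(** Differentiating v^(n-j) x^(p+i) e^(-x) gives a diagonal term and a shift from i to i + 1; the
    source term at i = 0 comes from the derivative of [Theta]. The factor 1 / i! taken out in
    [Phi_tail] turns the shift coefficient into i / s and lets the sum be compared with an
    exponential series. *)
Fixpoint tail_coef (j i : nat) : R :=
  match j with
  | O => 0
  | S j =>
      (INR n - INR j - INR (p + i) / s) * tail_coef j i +
      match i with
      | O => - falling j * (INR p / (s * INR (fact p)))
      | S i' => INR i / s * tail_coef j i'
      end
  end.

Definition Phi_tail (j : nat) (z : C) : C :=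
  psum (fun i => RtoC (tail_coef j i / INR (fact i)) * xexp (p + i) z)%C j.

(* In the coordinate z = log v, the j-th derivative with respect to v of
   v ^ n * Theta_p. *)
Definition Phi (j : nat) (z : C) : C :=
  (Cexp (RtoC (INR n - INR j) * z) *
   (RtoC (falling j) * Theta p z + Phi_tail j z))%C.

Context (Hs : 0 < s).

Lemma xpow_plus (k l : nat) (z : C) : xpow (k + l) z = (xpow k z * xpow l z)%C.
Proof.
unfold xpow; rewrite <- Cexp_plus, plus_INR; f_equal.
rewrite <- Cmult_plus_distr_r, <- RtoC_plus; f_equal; f_equal; field; lra.
Qed.

Lemma xexp_S (k : nat) (z : C) : xexp (S k) z = (xpow 1 z * xexp k z)%C.
Proof.
unfold xexp; replace (S k) with (1 + k)%nat by lia; rewrite xpow_plus; ring.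
Qed.

Lemma Cderive_linear_Cexp (a : R) (z : C) :
  Cderive (fun w => Cexp (a * w)%C) z (a * Cexp (a * z))%C.
Proof.
eapply Cderive_ext; [| |apply (Cderive_Cexp_affine a 0%C)].
- intros w; simpl; f_equal; ring.
- simpl; do 2 f_equal; ring.
Qed.

Lemma Cderive_xexp (k : nat) (z : C) :
  Cderive (xexp k) z
    (RtoC (- (INR k / s)) * xexp k z + RtoC (/ s) * xexp (S k) z)%C.
Proof.
assert (E : Cderive (fun w => Cexp (- xpow 1 w)%C) z
  ((- (1)) * (RtoC (- (INR 1 / s)) * xpow 1 z) * Cexp (- xpow 1 z))%C).
{ apply (Cderive_comp Cexp (fun w => - xpow 1 w)%C); [apply Cderive_Cexp|].
  eapply Cderive_ext; [| |apply (Cderive_scal (- (1))%C), (Cderive_linear_Cexp (- (INR 1 / s)))].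
  - intros w; unfold xpow; simpl; ring.
  - reflexivity. }
eapply Cderive_ext; [| |apply (Cderive_mult _ _ z _ _
  (Cderive_linear_Cexp (- (INR k / s)) z) E)].
- reflexivity.
- rewrite xexp_S; unfold xexp; fold (xpow k z).
  replace (RtoC (- (INR 1 / s))) with (- RtoC (/ s))%C; [ring|].
  rewrite <- RtoC_opp; f_equal; simpl; field; lra.
Qed.

(** The sum telescopes: the derivative in x is x^(q-1) e^(-x) / (q-1)!, and dx/dz = - x / s. Writing
    1 / (q-1)! as q / q! also covers q = 0. *)
Lemma Cderive_Theta (q : nat) (z : C) :
  Cderive (Theta q) z (RtoC (- (INR q / (s * INR (fact q)))) * xexp q z)%C.
Proof.
induction q as [|q IH].
- eapply Cderive_ext; [reflexivity| |apply (Cderive_const 1%C)].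
  replace (- (INR 0 / _)) with 0 by (simpl; field; lra); ring.
- eapply Cderive_ext; [| |apply (Cderive_plus _ _ z _ _ IH
    (Cderive_scal (- RtoC (/ INR (fact q)))%C _ _ _ (Cderive_xexp q z)))].
  + intros w; simpl; ring.
  + rewrite xexp_S.
    pose proof (INR_fact_neq_0 q) as Hf.
    assert (Hq : INR (S q) <> 0) by (apply not_0_INR; lia).
    replace (RtoC (- (INR (S q) / (s * INR (fact (S q))))))
      with (- (RtoC (/ INR (fact q)) * RtoC (/ s)))%C.
    2:{ rewrite <- RtoC_mult, <- RtoC_opp; f_equal.
        rewrite fact_simpl, mult_INR; field; repeat split; trivial; lra. }
    replace (RtoC (- (INR q / (s * INR (fact q)))))
      with (RtoC (/ INR (fact q)) * RtoC (- (INR q / s)))%C.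
    2:{ rewrite <- RtoC_mult; f_equal; field; split; trivial; lra. }
    ring.
Qed.

Lemma tail_coef_zero (j i : nat) : (j <= i)%nat -> tail_coef j i = 0.
Proof.
revert i; induction j as [|j IH]; intros i Hi; trivial; simpl.
rewrite IH by lia; destruct i as [|i]; [lia|]; rewrite IH by lia; ring.
Qed.

Lemma Phi_tail_S (j : nat) (z : C) :
  Phi_tail (S j) z =
  (RtoC (INR n - INR j) * Phi_tail j z +
   RtoC (falling j) * (RtoC (- (INR p / (s * INR (fact p)))) * xexp p z) +
   psum (fun i => RtoC (tail_coef j i / INR (fact i)) *
     (RtoC (- (INR (p + i) / s)) * xexp (p + i) z +
      RtoC (/ s) * xexp (S (p + i)) z)) j)%C.
Proof.
unfold Phi_tail.
(* [A] collects the terms that keep the power x^(p+i); [B] collects those that reach it from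
   x^(p+i-1), with the source term as [B 0]. *)
set (A := fun i => (RtoC (INR n - INR j) *
  (RtoC (tail_coef j i / INR (fact i)) * xexp (p + i) z) +
  RtoC (tail_coef j i / INR (fact i)) * (RtoC (- (INR (p + i) / s)) * xexp (p + i) z))%C).
set (B := fun i : nat => match i with
  | O => (RtoC (falling j) * (RtoC (- (INR p / (s * INR (fact p)))) * xexp p z))%C
  | S i => (RtoC (tail_coef j i / INR (fact i)) * (RtoC (/ s) * xexp (S (p + i)) z))%C
  end).
transitivity (psum (fun i => A i + B i)%C (S j)).
- apply psum_ext; intros i _; unfold A, B.
  pose proof (INR_fact_neq_0 i) as Hi; pose proof (INR_fact_neq_0 p) as Hp.
  destruct i as [|i].
  + rewrite Nat.add_0_r in *; simpl tail_coef; simpl fact.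
    rewrite Nat.add_0_r.
    rewrite !Cmult_assoc, <- !RtoC_mult, <- !Cmult_plus_distr_r, <- !RtoC_plus.
    f_equal; f_equal; simpl; field; split; trivial; lra.
  + pose proof (INR_fact_neq_0 i) as Hi'.
    assert (Hn : INR (S i) <> 0) by (apply not_0_INR; lia).
    replace (S (p + i)) with (p + S i)%nat by lia.
    rewrite !Cmult_assoc, <- !RtoC_mult, <- !Cmult_plus_distr_r, <- !RtoC_plus.
    f_equal; f_equal; cbn [tail_coef].
    rewrite fact_simpl, mult_INR in *.
    field; repeat split; trivial; lra.
- rewrite psum_plus, (psum_split_first B).
  transitivity (psum A j + (B O + psum (fun i => B (S i)) j))%C.
  (* The top diagonal term vanishes, since at order j only the indices below j carry a
     coefficient. *)
  { f_equal; simpl; unfold A at 2; rewrite tail_coef_zero by lia.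
    unfold Rdiv at 1 2; rewrite Rmult_0_l; ring. }
  unfold A; rewrite psum_plus, psum_scal.
  rewrite (psum_ext (fun i => _ * (_ + _))%C
    (fun i => RtoC (tail_coef j i / INR (fact i)) * (RtoC (- (INR (p + i) / s)) * xexp (p + i) z)
      + B (S i))%C) by (intros i _; unfold B; ring).
  rewrite psum_plus; unfold B; ring.
Qed.

Lemma Cderive_Phi (j : nat) (z : C) :
  Cderive (Phi j) z (Cexp z * Phi (S j) z)%C.
Proof.
eapply Cderive_ext; [| |apply (Cderive_mult _ _ z _ _
  (Cderive_linear_Cexp (INR n - INR j) z)
  (Cderive_plus _ _ z _ _ (Cderive_scal (RtoC (falling j)) _ _ _ (Cderive_Theta p z))
    (Cderive_psum (fun i w => RtoC (tail_coef j i / INR (fact i)) * xexp (p + i) w)%C _ z j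
       (fun i => Cderive_scal _ _ _ _ (Cderive_xexp (p + i) z)))))].
- reflexivity.
- unfold Phi; rewrite Phi_tail_S; fold (Phi_tail j z).
  replace (Cexp (RtoC (INR n - INR j) * z))%C with
    (Cexp z * Cexp (RtoC (INR n - INR (S j)) * z))%C.
  2:{ rewrite <- Cexp_plus; f_equal; rewrite S_INR, !RtoC_minus, RtoC_plus; ring. }
  cbn [falling]; rewrite RtoC_mult; ring.
Qed.

End Blocks.

(** * Estimates *)

Lemma pow_le_fact_exp (y : R) (k : nat) : 0 <= y -> y ^ k <= INR (fact k) * exp y.
Proof.
intros Hy; pose proof (INR_fact_lt_0 k) as Hk.
assert (H : y ^ k / INR (fact k) <= exp y).
{ eapply Rle_trans; [|apply (exp_ge_taylor y k Hy)].
  destruct k as [|k]; [simpl; lra|]; rewrite tech5.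
  assert (0 <= sum_f_R0 (fun i => y ^ i / INR (fact i)) k); [|lra].
  apply cond_pos_sum; intros i; apply Rdiv_le_0_compat; [now apply pow_le|apply INR_fact_lt_0]. }
apply Rmult_le_compat_l with (r := INR (fact k)) in H; [|lra].
replace (INR (fact k) * (y ^ k / INR (fact k))) with (y ^ k) in H by (field; lra); exact H.
Qed.

Lemma pow_le_fact_exp_scaled (y e : R) (k : nat) :
  0 <= y -> 0 < e -> y ^ k <= (/ e) ^ k * INR (fact k) * exp (e * y).
Proof.
intros Hy He; pose proof (pow_le_fact_exp (e * y) k) as H.
rewrite Rpow_mult_distr in H.
apply Rmult_le_reg_l with (e ^ k); [now apply pow_lt|].
replace (e ^ k * ((/ e) ^ k * INR (fact k) * exp (e * y))) with
  ((e * / e) ^ k * (INR (fact k) * exp (e * y))) by (rewrite Rpow_mult_distr; ring).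
rewrite Rinv_r, pow1, Rmult_1_l by lra; apply H; nra.
Qed.

(** A binomial coefficient is at most 2^(a+b). As in Pascal's rule, the new factor (a+1) + (b+1) is
    split between the two smaller pairs. *)
Lemma fact_plus_le (a b : nat) :
  INR (fact (a + b)) <= 2 ^ (a + b) * INR (fact a) * INR (fact b).
Proof.
remember (a + b)%nat as m eqn:E; revert a b E.
induction m as [|m IH]; intros a b E.
{ assert (a = 0%nat) by lia; assert (b = 0%nat) by lia; subst; simpl; lra. }
destruct a as [|a], b as [|b]; try lia.
- simpl in E; injection E as E; subst m.
  pose proof (pow_R1_Rle 2 (S b)); pose proof (INR_fact_lt_0 (S b)).
  simpl (fact 0); simpl (INR 1); nra.
- replace m with a by lia.
  pose proof (pow_R1_Rle 2 (S a)); pose proof (INR_fact_lt_0 (S a)).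
  simpl (fact 0); simpl (INR 1); nra.
- pose proof (IH a (S b) ltac:(lia)) as H1; pose proof (IH (S a) b ltac:(lia)) as H2.
  assert (E' : INR (S m) = INR (S a) + INR (S b)) by (rewrite E, plus_INR; trivial).
  rewrite (fact_simpl m), mult_INR, E', (fact_simpl a), (fact_simpl b), !mult_INR in *.
  pose proof (pos_INR (S a)); pose proof (pos_INR (S b)).
  pose proof (INR_fact_lt_0 m).
  apply Rmult_le_compat_l with (r := INR (S a)) in H1; trivial.
  apply Rmult_le_compat_l with (r := INR (S b)) in H2; trivial.
  simpl pow; nra.
Qed.

(** Stability under sums and products allows constants to be collected without naming them. The
    exponent n + j + 1, rather than n + j, leaves room for constants at n = j = 0. *)
Definition geo (f : nat -> nat -> R) : Prop :=
  exists B, 1 <= B /\ forall n j, 0 <= f n j <= B ^ S (n + j).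

Lemma geo_le (f g : nat -> nat -> R) :
  (forall n j, 0 <= f n j <= g n j) -> geo g -> geo f.
Proof.
intros H [B [HB Hg]]; exists B; split; trivial; intros n j.
specialize (H n j); specialize (Hg n j); lra.
Qed.

Lemma geo_mult (f g : nat -> nat -> R) : geo f -> geo g -> geo (fun n j => f n j * g n j).
Proof.
intros [B [HB Hf]] [B' [HB' Hg]]; exists (B * B'); split; [nra|]; intros n j.
specialize (Hf n j); specialize (Hg n j); rewrite Rpow_mult_distr.
split; [apply Rmult_le_pos; lra|apply Rmult_le_compat; lra].
Qed.

Lemma geo_plus (f g : nat -> nat -> R) : geo f -> geo g -> geo (fun n j => f n j + g n j).
Proof.
intros [B [HB Hf]] [B' [HB' Hg]]; exists (B + B'); split; [lra|]; intros n j.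
specialize (Hf n j); specialize (Hg n j); split; [lra|].
apply Rle_trans with (B ^ S (n + j) + B' ^ S (n + j)); [lra|].
generalize (n + j)%nat; intros m.
assert (B ^ m <= (B + B') ^ m) by (apply pow_incr; lra).
assert (B' ^ m <= (B + B') ^ m) by (apply pow_incr; lra).
simpl; nra.
Qed.

Lemma geo_const (c : R) : 0 <= c -> geo (fun _ _ => c).
Proof.
intros Hc; exists (1 + c); split; [lra|]; intros n j; split; trivial.
simpl; pose proof (pow_R1_Rle (1 + c) (n + j)); nra.
Qed.

Lemma geo_pow_l (c : R) : 0 <= c -> geo (fun n _ => c ^ n).
Proof.
intros Hc; exists (1 + c); split; [lra|]; intros n j; split; [now apply pow_le|].
apply Rle_trans with ((1 + c) ^ n); [apply pow_incr; lra|apply Rle_pow; [lra|lia]].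
Qed.

Lemma geo_pow_r (c : R) : 0 <= c -> geo (fun _ j => c ^ j).
Proof.
intros Hc; exists (1 + c); split; [lra|]; intros n j; split; [now apply pow_le|].
apply Rle_trans with ((1 + c) ^ j); [apply pow_incr; lra|apply Rle_pow; [lra|lia]].
Qed.

Lemma geo_pow_lS (c : R) : 0 <= c -> geo (fun n _ => c ^ S n).
Proof.
intros Hc; apply (geo_mult (fun _ _ => c) (fun n _ => c ^ n));
  [now apply geo_const|now apply geo_pow_l].
Qed.

(** * Real powers, factorials and exponential decay *)

Lemma Rpower_neg_anti (a b q : R) :
  0 < a <= b -> 0 <= q -> Rpower b (- q) <= Rpower a (- q).
Proof.
intros Hab Hq; rewrite !Rpower_Ropp.
apply Rinv_le_contravar; [apply exp_pos|now apply Rle_Rpower_l].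
Qed.

Lemma Rpower_nonneg (a b : R) : 0 <= Rpower a b.
Proof. apply Rlt_le, exp_pos. Qed.

(** The s-th power of y^j <= (s / e)^j j! e^((e / s) y). This is the source of the Gevrey factor
    (j!)^s. *)
Lemma Rpower_exp_decay (s e y : R) (j : nat) :
  0 < s -> 0 < e -> 0 < y ->
  Rpower y (s * INR j) * exp (- (e * y)) <= Rpower (s / e) s ^ j * Rpower (INR (fact j)) s.
Proof.
intros Hs He Hy.
assert (Hes : 0 < e / s) by (now apply Rdiv_lt_0_compat).
pose proof (pow_le_fact_exp_scaled y (e / s) j (Rlt_le _ _ Hy) Hes) as H.
assert (Hse : / (e / s) = s / e) by (field; lra); rewrite Hse in H.
assert (Hq : 0 < s / e) by (now apply Rdiv_lt_0_compat).
pose proof (pow_lt _ j Hq) as Hqj; pose proof (INR_fact_lt_0 j) as Hj.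
assert (P := Rle_Rpower_l _ _ s (Rlt_le _ _ Hs) (conj (pow_lt _ j Hy) H)).
rewrite <- !Rpower_mult_distr in P; try apply exp_pos; trivial;
  try (now apply Rmult_lt_0_compat).
rewrite <- !Rpower_pow in P by trivial.
rewrite !Rpower_mult in P.
rewrite <- Rpower_pow, Rpower_mult by apply exp_pos.
rewrite (Rmult_comm s (INR j)).
assert (X : Rpower (exp (e / s * y)) s = exp (e * y)).
{ unfold Rpower; rewrite ln_exp; f_equal; field; lra. }
rewrite X in P.
apply Rmult_le_reg_r with (exp (e * y)); [apply exp_pos|].
rewrite Rmult_assoc, <- exp_plus, Rplus_opp_l, exp_0, Rmult_1_r; exact P.
Qed.

Lemma pow_div_fact_decay (y e : R) (p : nat) :
  0 <= y -> 0 < e -> y ^ p / INR (fact p) * exp (- (e * y)) <= (/ e) ^ p.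
Proof.
intros Hy He; pose proof (pow_le_fact_exp_scaled y e p Hy He) as H.
pose proof (INR_fact_lt_0 p) as Hp.
apply Rmult_le_reg_r with (INR (fact p) * exp (e * y)).
{ apply Rmult_lt_0_compat; trivial; apply exp_pos. }
replace (y ^ p / INR (fact p) * exp (- (e * y)) * (INR (fact p) * exp (e * y)))
  with (y ^ p * exp (- (e * y) + e * y)) by (rewrite exp_plus; field; lra).
rewrite Rplus_opp_l, exp_0; lra.
Qed.

(* The two bounds on T are balanced at y = n + 1. *)
Lemma Rpower_mult_le_min (y T C D q : R) (n p : nat) :
  0 < y -> 0 <= T -> 0 <= q <= INR p -> 0 <= D -> 0 <= C ->
  T <= C * (y ^ p / INR (fact p)) -> T <= D ->
  Rpower y (- q) * T <= (C * exp (INR (S n)) + D) * Rpower (INR (S n)) (- q).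
Proof.
intros Hy HT Hq HD HC H1 H2.
assert (Hn : 0 < INR (S n)) by (apply lt_0_INR; lia).
pose proof (INR_fact_lt_0 p) as Hp.
pose proof (exp_pos (INR (S n))) as Hx.
destruct (Rle_lt_dec y (INR (S n))) as [L|L].
(* Below n + 1 the exponent p - q is nonnegative, so the power of y is largest at n + 1, and (n +
   1)^p / p! <= e^(n+1) whatever p is. *)
- apply Rle_trans with (C * exp (INR (S n)) * Rpower (INR (S n)) (- q)).
  2:{ apply Rmult_le_compat_r; [apply Rpower_nonneg|lra]. }
  apply Rle_trans with (C * (Rpower y (INR p - q) / INR (fact p))).
  { eapply Rle_trans; [apply Rmult_le_compat_l; [apply Rpower_nonneg|exact H1]|].
    unfold Rminus; rewrite Rpower_plus, Rpower_pow by trivial; right; field; lra. }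
  rewrite Rmult_assoc; apply Rmult_le_compat_l; trivial.
  apply Rle_trans with (Rpower (INR (S n)) (INR p - q) / INR (fact p)).
  { apply Rmult_le_compat_r; [apply Rlt_le, Rinv_0_lt_compat; trivial|].
    apply Rle_Rpower_l; lra. }
  unfold Rminus; rewrite Rpower_plus, Rpower_pow by trivial.
  pose proof (pow_le_fact_exp (INR (S n)) p (Rlt_le _ _ Hn)) as H.
  replace (INR (S n) ^ p * Rpower (INR (S n)) (- q) / INR (fact p))
    with ((INR (S n) ^ p / INR (fact p)) * Rpower (INR (S n)) (- q)) by (field; lra).
  apply Rmult_le_compat_r; [apply Rpower_nonneg|].
  apply Rmult_le_reg_r with (INR (fact p)); trivial.
  unfold Rdiv; rewrite Rmult_assoc, Rinv_l by lra; lra.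
- apply Rle_trans with (Rpower (INR (S n)) (- q) * D).
  + apply Rmult_le_compat; trivial; [apply Rpower_nonneg|].
    apply Rpower_neg_anti; lra.
  + rewrite Rmult_comm; apply Rmult_le_compat_r; [apply Rpower_nonneg|].
    assert (0 <= C * exp (INR (S n))) by (apply Rmult_le_pos; lra); lra.
Qed.

(** It combines (n + 1)^j <= j! e^(n+1) with n! <= (n + 1)^n, and raises the quotient to the power
    s. *)
Lemma Rpower_S_le_fact (s : R) (n j : nat) :
  0 <= s ->
  Rpower (INR (S n)) (s * (INR j - INR n)) <=
  exp s ^ S n * Rpower (INR (fact j) / INR (fact n)) s.
Proof.
intros Hs.
assert (Hn : 0 < INR (S n)) by (apply lt_0_INR; lia).
pose proof (INR_fact_lt_0 n) as Fn; pose proof (INR_fact_lt_0 j) as Fj.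
rewrite Rmult_comm, <- Rpower_mult.
assert (E : exp s ^ S n = Rpower (exp (INR (S n))) s).
{ rewrite <- Rpower_pow by apply exp_pos; unfold Rpower; rewrite !ln_exp; f_equal; ring. }
assert (D : 0 < INR (fact j) / INR (fact n)) by (now apply Rdiv_lt_0_compat).
rewrite E, Rpower_mult_distr by (trivial; apply exp_pos).
apply Rle_Rpower_l; trivial; split; [apply exp_pos|].
unfold Rminus; rewrite Rpower_plus, Rpower_Ropp, !Rpower_pow by trivial.
pose proof (pow_le_fact_exp (INR (S n)) j (Rlt_le _ _ Hn)) as H.
assert (G : INR (fact n) <= INR (S n) ^ n).
{ clear; induction n as [|n IH]; [simpl; lra|].
  rewrite fact_simpl, mult_INR.
  apply Rle_trans with (INR (S n) * INR (S n) ^ n).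
  - apply Rmult_le_compat_l; [apply pos_INR|trivial].
  - change (INR (S n) ^ S n <= INR (S (S n)) ^ S n).
    apply pow_incr; split; [apply pos_INR|apply le_INR; lia]. }
apply Rmult_le_reg_r with (INR (S n) ^ n); [now apply pow_lt|].
rewrite Rmult_assoc, Rinv_l, Rmult_1_r by (apply pow_nonzero; lra).
apply (Rle_trans _ _ _ H).
replace (exp (INR (S n)) * (INR (fact j) / INR (fact n)) * INR (S n) ^ n) with
  (INR (fact j) * exp (INR (S n)) * (INR (S n) ^ n / INR (fact n))) by (field; lra).
rewrite <- (Rmult_1_r (INR (fact j) * exp (INR (S n)))) at 1.
apply Rmult_le_compat_l.
- apply Rmult_le_pos; [lra|apply Rlt_le, exp_pos].
- apply Rmult_le_reg_r with (INR (fact n)); trivial.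
  unfold Rdiv; rewrite Rmult_assoc, Rinv_l by lra; lra.
Qed.

(** * Bounds for the building blocks *)

Section BlockBounds.

Context (s : R) (n p : nat) (Hs : 0 < s).

Lemma falling_zero (j : nat) : (n < j)%nat -> falling n j = 0.
Proof.
induction j as [|j IH]; [lia|]; intros Hj; simpl.
destruct (Nat.eq_dec n j) as [->|]; [ring|rewrite IH by lia; ring].
Qed.

Lemma INR_Rabs_minus (a b : nat) : Rabs (INR a - INR b) <= INR a + INR b.
Proof.
pose proof (pos_INR a); pose proof (pos_INR b).
unfold Rabs; destruct Rcase_abs; lra.
Qed.

(** Far from sharp, but the majorant is the one that also governs the tail coefficients, and it
    costs only j! times a geometric factor. *)
Lemma falling_bound (j : nat) :
  Rabs (falling n j) <= INR (fact (n + p + j)) / INR (fact (n + p)).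
Proof.
pose proof (INR_fact_lt_0 (n + p)) as H0.
induction j as [|j IH].
- simpl; rewrite Nat.add_0_r, Rabs_R1; right; field; lra.
- simpl falling; rewrite Nat.add_succ_r, fact_simpl, mult_INR, Rabs_mult.
  unfold Rdiv; rewrite Rmult_assoc; apply Rmult_le_compat; try apply Rabs_pos; trivial.
  eapply Rle_trans; [apply INR_Rabs_minus|].
  rewrite S_INR, !plus_INR; pose proof (pos_INR p); lra.
Qed.

(** With N = n + p + j + 1, one step of the recursion costs at most (1 + 1/s) N for the diagonal
    term and N / s for the other one, shift or source; (1 + 3/s) N covers both. The factor p / p! is
    inherited from the source term. *)
Lemma tail_coef_bound (j i : nat) :
  Rabs (tail_coef s n p j i) <=
  INR p / INR (fact p) * (1 + 3 / s) ^ j *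
  (INR (fact (n + p + j)) / INR (fact (n + p))).
Proof.
pose proof (INR_fact_lt_0 (n + p)) as H0; pose proof (INR_fact_lt_0 p) as Hp.
assert (H3 : 0 < 3 / s) by (apply Rdiv_lt_0_compat; lra).
assert (His : 0 < / s) by (now apply Rinv_0_lt_compat).
assert (HP : 0 <= INR p / INR (fact p)) by (apply Rdiv_le_0_compat; [apply pos_INR|trivial]).
revert i; induction j as [|j IH]; intros i.
{ simpl tail_coef; rewrite Rabs_R0; apply Rmult_le_pos.
  - apply Rmult_le_pos; [exact HP|apply pow_le; lra].
  - apply Rdiv_le_0_compat; [apply pos_INR|trivial]. }
set (Q := INR p / INR (fact p) * (1 + 3 / s) ^ j *
  (INR (fact (n + p + j)) / INR (fact (n + p)))) in *.
assert (HQ0 : 0 <= Q) by exact (Rle_trans _ _ _ (Rabs_pos _) (IH O)).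
set (N := INR (S (n + p + j))).
assert (EN : N = INR n + INR p + INR j + 1) by (unfold N; rewrite S_INR, !plus_INR; ring).
pose proof (pos_INR n); pose proof (pos_INR p); pose proof (pos_INR j).
replace (INR p / INR (fact p) * (1 + 3 / s) ^ S j * _) with ((1 + 3 / s) * N * Q).
2:{ unfold Q, N; rewrite Nat.add_succ_r, fact_simpl, mult_INR; simpl pow.
    field; repeat split; lra. }
destruct (le_lt_dec (S j) i) as [Hi|Hi].
{ rewrite tail_coef_zero by trivial; rewrite Rabs_R0.
  apply Rmult_le_pos; [apply Rmult_le_pos; lra|trivial]. }
assert (Hij : INR i <= INR j) by (apply le_INR; lia).
pose proof (pos_INR i) as Hi0.
assert (B1 : Rabs ((INR n - INR j - INR (p + i) / s) * tail_coef s n p j i)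
  <= (1 + / s) * N * Q).
{ rewrite Rabs_mult; apply Rmult_le_compat; try apply Rabs_pos; [|apply IH].
  unfold Rminus at 1; eapply Rle_trans; [apply Rabs_triang|].
  rewrite Rabs_Ropp, plus_INR.
  pose proof (INR_Rabs_minus n j).
  rewrite (Rabs_pos_eq ((INR p + INR i) / s)) by (apply Rdiv_le_0_compat; lra).
  unfold Rdiv; assert ((INR p + INR i) * / s <= N * / s) by (apply Rmult_le_compat_r; lra).
  lra. }
simpl tail_coef; eapply Rle_trans; [apply Rabs_triang|].
replace ((1 + 3 / s) * N * Q) with ((1 + / s) * N * Q + 2 * (/ s * N * Q)) by (field; lra).
apply Rplus_le_compat; trivial.
assert (HX : 0 <= / s * N * Q) by (apply Rmult_le_pos; [apply Rmult_le_pos; lra|trivial]).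
destruct i as [|i].
- apply Rle_trans with (/ s * N * Q); [|lra].
  rewrite Rabs_mult, Rabs_Ropp.
  rewrite (Rabs_pos_eq (INR p / (s * INR (fact p)))).
  2:{ apply Rdiv_le_0_compat; [lra|now apply Rmult_lt_0_compat]. }
  pose proof (falling_bound j) as HF.
  set (F := INR (fact (n + p + j)) / INR (fact (n + p))) in *.
  assert (F0 : 0 <= F) by exact (Rle_trans _ _ _ (Rabs_pos _) HF).
  apply Rle_trans with (F * (INR p / (s * INR (fact p)))).
  + apply Rmult_le_compat_r; trivial.
    apply Rdiv_le_0_compat; [lra|now apply Rmult_lt_0_compat].
  + pose proof (pow_R1_Rle (1 + 3 / s) j ltac:(lra)).
    replace (F * (INR p / (s * INR (fact p)))) with
      (/ s * 1 * (INR p / INR (fact p) * 1 * F)) by (field; lra).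
    unfold Q; apply Rmult_le_compat.
    * lra.
    * apply Rmult_le_pos; [lra|trivial].
    * apply Rmult_le_compat_l; lra.
    * apply Rmult_le_compat_r; trivial; apply Rmult_le_compat_l; trivial.
- apply Rle_trans with (/ s * N * Q); [|lra].
  rewrite Rabs_mult; apply Rmult_le_compat; try apply Rabs_pos; [|apply IH].
  rewrite Rabs_pos_eq by (apply Rdiv_le_0_compat; lra).
  unfold Rdiv; rewrite Rmult_comm; apply Rmult_le_compat_l; lra.
Qed.

Context (z : C) (delta : R) (Hdelta : 0 < delta <= 1).

(** This is |x|; the hypothesis on the cosine then says Re x >= delta |x|. *)
Let y := exp (- (fst z / s)).

Context (Hcos : delta <= cos (snd z / s)).

Lemma y_pos : 0 < y.
Proof. apply exp_pos. Qed.

Lemma Cmod_xpow (k : nat) : Cmod (xpow s k z) = y ^ k.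
Proof.
unfold xpow, y; rewrite Cmod_Cexp; simpl.
rewrite <- Rpower_pow by apply exp_pos; unfold Rpower; rewrite ln_exp.
f_equal; field; lra.
Qed.

Lemma fst_xpow1 : delta * y <= fst (xpow s 1 z).
Proof.
unfold xpow, Cexp, y; simpl.
replace (- (1 / s) * fst z - 0 * snd z) with (- (fst z / s)) by (field; lra).
replace (- (1 / s) * snd z + 0 * fst z) with (- (snd z / s)) by (field; lra).
rewrite cos_neg, Rmult_comm; apply Rmult_le_compat_l; [apply Rlt_le, exp_pos|trivial].
Qed.

Lemma Cmod_xexp (k : nat) : Cmod (xexp s k z) <= y ^ k * exp (- (delta * y)).
Proof.
unfold xexp; rewrite Cmod_mult, Cmod_xpow, Cmod_Cexp.
apply Rmult_le_compat_l; [apply pow_le, Rlt_le, y_pos|].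
apply exp_monotone; pose proof fst_xpow1; simpl fst in *; lra.
Qed.

(** Each x^k e^(-x) / k! is at most delta^(-k), uniformly in x. The bound ignores cancellation and
    serves when x is large. *)
Lemma Theta_bound_large (q : nat) : Cmod (Theta s q z) <= (2 / delta) ^ q.
Proof.
assert (Hd : 1 <= / delta) by (rewrite <- Rinv_1; apply Rinv_le_contravar; lra).
induction q as [|q IH]; [simpl; rewrite Cmod_1; lra|].
simpl Theta; unfold Cminus; eapply Rle_trans; [apply Cmod_triangle|].
rewrite Cmod_opp, Cmod_mult, Cmod_R.
pose proof (INR_fact_lt_0 q) as Hq.
rewrite Rabs_pos_eq by (apply Rlt_le, Rinv_0_lt_compat; trivial).
assert (H : / INR (fact q) * Cmod (xexp s q z) <= (/ delta) ^ q).
{ eapply Rle_trans; [|apply (pow_div_fact_decay y delta q); [apply Rlt_le, y_pos|lra]].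
  unfold Rdiv; rewrite (Rmult_comm (y ^ q)), Rmult_assoc.
  apply Rmult_le_compat_l; [apply Rlt_le, Rinv_0_lt_compat; trivial|apply Cmod_xexp]. }
assert (H2 : (/ delta) ^ q <= (2 / delta) ^ q) by (apply pow_incr; lra).
pose proof (pow_le (2 / delta) q ltac:(lra)).
simpl; nra.
Qed.

(* [Theta q] along the ray from 0 to x, where x = Cexp (- z / s). *)
Fixpoint Theta_ray (q : nat) (t : C) : C :=
  match q with
  | O => 1%C
  | S q => (Theta_ray q t - RtoC (/ INR (fact q)) * xpow s q z *
      (t ^ q * Cexp (- xpow s 1 z * t + 0)))%C
  end.

Lemma Cderive_pow (q : nat) (t : C) :
  Cderive (fun t => t ^ S q)%C t (INR (S q) * t ^ q)%C.
Proof.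
induction q as [|q IH].
- eapply Cderive_ext; [| |apply (Cderive_affine 1%C 0%C)].
  + intros x; simpl; ring.
  + simpl; ring.
- eapply Cderive_ext; [| |apply (Cderive_mult (fun t => t) (fun t => t ^ S q)%C t 1%C);
    [|exact IH]].
  + reflexivity.
  + rewrite (S_INR (S q)), RtoC_plus; simpl; ring.
  + eapply Cderive_ext; [| |apply (Cderive_affine 1%C 0%C)]; [intros x; simpl; ring|reflexivity].
Qed.

Lemma Cderive_Theta_ray (q : nat) (t : C) :
  Cderive (Theta_ray (S q)) t
    (RtoC (/ INR (fact q)) * xpow s (S q) z *
      (t ^ q * Cexp (- xpow s 1 z * t + 0)))%C.
Proof.
induction q as [|q IH].
- eapply Cderive_ext; [| |apply (Cderive_plus (fun _ => 1%C)
    (fun t => - (1) * Cexp (- xpow s 1 z * t + 0))%C t 0%C); [apply Cderive_const|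
    apply Cderive_scal, Cderive_Cexp_affine]].
  + intros x; simpl.
    replace (xpow s 0 z) with (RtoC 1); [rewrite Rinv_1; ring|].
    unfold xpow; replace (RtoC (- (INR 0 / s)) * z)%C with (RtoC 0);
      [symmetry; apply Cexp_0|].
    replace (- (INR 0 / s)) with 0 by (simpl; field; lra); ring.
  + simpl; rewrite Rinv_1; ring.
- eapply Cderive_ext; [| |apply (Cderive_plus _ _ t _ _ IH
    (Cderive_scal (- (RtoC (/ INR (fact (S q))) * xpow s (S q) z))%C _ _ _
      (Cderive_mult _ _ t _ _ (Cderive_pow q t)
        (Cderive_Cexp_affine (- xpow s 1 z)%C 0%C t))))].
  + intros x; change (Theta_ray (S (S q)) x) with (Theta_ray (S q) x -
      RtoC (/ INR (fact (S q))) * xpow s (S q) z *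
      (x ^ S q * Cexp (- xpow s 1 z * x + 0)))%C; cbv beta; ring.
  + replace (xpow s (S (S q)) z) with (xpow s 1 z * xpow s (S q) z)%C.
    2:{ rewrite <- xpow_plus by trivial; reflexivity. }
    replace (RtoC (/ INR (fact q))) with (RtoC (/ INR (fact (S q))) * RtoC (INR (S q)))%C.
    * ring.
    * rewrite <- RtoC_mult; f_equal; pose proof (INR_fact_neq_0 q).
      rewrite fact_simpl, mult_INR; field; split; trivial; apply not_0_INR; lia.
Qed.

Lemma Theta_ray_0 (q : nat) : Theta_ray (S q) 0%C = 0%C.
Proof.
induction q as [|q IH].
- simpl; rewrite Rinv_1.
  replace (- xpow s 1 z * 0 + 0)%C with (RtoC 0) by ring; rewrite Cexp_0.
  replace (xpow s 0 z) with (RtoC 1); [ring|].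
  unfold xpow; replace (RtoC (- (INR 0 / s)) * z)%C with (RtoC 0);
    [symmetry; apply Cexp_0|].
  replace (- (INR 0 / s)) with 0 by (simpl; field; lra); ring.
- change (Theta_ray (S (S q)) 0%C) with (Theta_ray (S q) 0%C -
      RtoC (/ INR (fact (S q))) * xpow s (S q) z *
      (0 ^ S q * Cexp (- xpow s 1 z * 0 + 0)))%C.
  rewrite IH; simpl; ring.
Qed.

Lemma Theta_ray_1 (q : nat) : Theta_ray q 1%C = Theta s q z.
Proof.
induction q as [|q IH]; trivial; simpl; rewrite IH.
rewrite Cpow_1_l.
replace (- xpow s 1 z * 1 + 0)%C with (- xpow s 1 z)%C by ring.
unfold xexp; ring.
Qed.

(** [Theta q] is the remainder x^q / (q-1)! times the integral of t^(q-1) e^(-x t) over [0, 1], and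
    |e^(-x t)| <= 1 because Re x > 0. The integral appears as an increment along the ray, compared
    with y^q t^q / q!. *)
Lemma Theta_bound_small (q : nat) : Cmod (Theta s q z) <= y ^ q / INR (fact q).
Proof.
destruct q as [|q]; [simpl; rewrite Cmod_1; lra|].
pose proof (INR_fact_lt_0 (S q)) as Hq.
rewrite <- Theta_ray_1.
replace (Theta_ray (S q) 1%C) with (Theta_ray (S q) (0 + 1) - Theta_ray (S q) 0)%C
  by (rewrite Theta_ray_0, Cplus_0_l; ring).
replace (y ^ S q / INR (fact (S q))) with
  (y ^ S q / INR (fact (S q)) * 1 ^ S q - y ^ S q / INR (fact (S q)) * 0 ^ S q)
  by (rewrite pow1, pow_i by lia; ring).
apply (Cderive_increment_le (Theta_ray (S q)) (fun t =>
    (RtoC (/ INR (fact q)) * xpow s (S q) z * (t ^ q * Cexp (- xpow s 1 z * t + 0)))%C)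
  0%C 1%C (fun t => y ^ S q / INR (fact (S q)) * t ^ S q)
  (fun t => y ^ S q / INR (fact (S q)) * (INR (S q) * t ^ q))).
- intros t _; apply Cderive_Theta_ray.
- intros t _; apply is_derive_scal, is_derive_Reals, (derivable_pt_lim_pow t (S q)).
- intros t Ht.
  replace (0 + t * 1)%C with (RtoC t) by ring.
  rewrite Cmult_1_l, !Cmod_mult, Cmod_R, Cmod_xpow, Cmod_pow, Cmod_R, Cmod_Cexp.
  pose proof (INR_fact_lt_0 q) as Hq'.
  rewrite !Rabs_pos_eq by (try apply Rlt_le, Rinv_0_lt_compat; lra).
  assert (He : exp (fst (- xpow s 1 z * t + 0)%C) <= 1).
  { rewrite <- exp_0; apply exp_monotone.
    pose proof fst_xpow1; pose proof y_pos.
    replace (fst (- xpow s 1 z * t + 0)%C) with (- (fst (xpow s 1 z) * t)) by (simpl; ring).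
    assert (0 <= delta * y) by (apply Rmult_le_pos; lra); nra. }
  replace (y ^ S q / INR (fact (S q)) * (INR (S q) * t ^ q)) with
    (/ INR (fact q) * y ^ S q * (t ^ q * 1)).
  2:{ rewrite fact_simpl, mult_INR; field; split; [lra|apply not_0_INR; lia]. }
  apply Rmult_le_compat_l.
  + apply Rmult_le_pos; [apply Rlt_le, Rinv_0_lt_compat; trivial|].
    apply pow_le, Rlt_le, y_pos.
  + apply Rmult_le_compat_l; trivial; apply pow_le; lra.
Qed.

(** As i < j, y^i <= eps^(-j) (eps y)^i, and the (eps y)^i / i! sum to at most e^(eps y). The extra
    powers of x thus cost a geometric factor and a fraction of the decay e^(- delta y). *)
Lemma Phi_tail_bound (eps : R) (j : nat) :
  0 < eps <= 1 ->
  Cmod (Phi_tail s n p j z) <=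
  INR p / INR (fact p) * (1 + 3 / s) ^ j *
  (INR (fact (n + p + j)) / INR (fact (n + p))) *
  ((/ eps) ^ j * y ^ p * exp (eps * y - delta * y)).
Proof.
intros Heps; pose proof y_pos as Hy.
assert (Hie : 1 <= / eps) by (rewrite <- Rinv_1; apply Rinv_le_contravar; lra).
set (Q := _ * (_ / _)).
assert (HQ : forall i, Rabs (tail_coef s n p j i) <= Q) by apply tail_coef_bound.
assert (HQ0 : 0 <= Q) by exact (Rle_trans _ _ _ (Rabs_pos _) (HQ O)).
unfold Phi_tail.
(* [sum_f_R0] includes its upper index, hence the shifted bound and the separate value 0 for the
   empty sum. *)
assert (S : forall m, (m <= j)%nat ->
  Cmod (psum (fun i => RtoC (tail_coef s n p j i / INR (fact i)) * xexp s (p + i) z)%C m) <=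
  Q * ((/ eps) ^ j * y ^ p * exp (- (delta * y))) *
  match m with O => 0 | S m => sum_f_R0 (fun k => (eps * y) ^ k / INR (fact k)) m end).
{ induction m as [|m IH]; intros Hm; [simpl; rewrite Cmod_0; lra|].
  simpl psum; eapply Rle_trans; [apply Cmod_triangle|].
  assert (T : Cmod (RtoC (tail_coef s n p j m / INR (fact m)) * xexp s (p + m) z)%C <=
    Q * ((/ eps) ^ j * y ^ p * exp (- (delta * y))) * ((eps * y) ^ m / INR (fact m))).
  { pose proof (INR_fact_lt_0 m) as Hf.
    assert (Hif : 0 < / INR (fact m)) by (now apply Rinv_0_lt_compat).
    rewrite Cmod_mult, Cmod_R; unfold Rdiv at 1; rewrite Rabs_mult.
    rewrite (Rabs_pos_eq (/ _)) by lra.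
    apply Rle_trans with (Q * / INR (fact m) * (y ^ (p + m) * exp (- (delta * y)))).
    - apply Rmult_le_compat; [|apply Cmod_ge_0| |apply Cmod_xexp].
      + apply Rmult_le_pos; [apply Rabs_pos|lra].
      + apply Rmult_le_compat_r; [lra|apply HQ].
    - rewrite pow_add, Rpow_mult_distr.
      replace (Q * / INR (fact m) * (y ^ p * y ^ m * exp (- (delta * y)))) with
        (Q * (1 * y ^ p * exp (- (delta * y))) * (y ^ m / INR (fact m))) by (field; lra).
      replace (Q * ((/ eps) ^ j * y ^ p * exp (- (delta * y))) *
        (eps ^ m * y ^ m / INR (fact m))) with
        (Q * ((/ eps) ^ j * eps ^ m * y ^ p * exp (- (delta * y))) * (y ^ m / INR (fact m)))
        by (field; lra).
      pose proof (pow_lt y p Hy); pose proof (pow_lt y m Hy).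
      pose proof (exp_pos (- (delta * y))).
      apply Rmult_le_compat_r; [apply Rmult_le_pos; lra|].
      apply Rmult_le_compat_l; trivial.
      apply Rmult_le_compat_r; [lra|]; apply Rmult_le_compat_r; [lra|].
      replace j with ((j - m) + m)%nat by lia.
      rewrite pow_add, Rmult_assoc, <- Rpow_mult_distr, Rinv_l, pow1, Rmult_1_r by lra.
      now apply pow_R1_Rle. }
  specialize (IH ltac:(lia)).
  destruct m as [|m]; [simpl in *; lra|].
  rewrite tech5, Rmult_plus_distr_l; lra. }
eapply Rle_trans; [apply (S j); lia|].
rewrite Rmult_assoc; apply Rmult_le_compat_l; trivial.
pose proof (pow_lt y p Hy); pose proof (exp_pos (- (delta * y))).
pose proof (pow_R1_Rle (/ eps) j Hie).
unfold Rminus; rewrite exp_plus.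
replace ((/ eps) ^ j * y ^ p * (exp (eps * y) * exp (- (delta * y)))) with
  ((/ eps) ^ j * y ^ p * exp (- (delta * y)) * exp (eps * y)) by ring.
apply Rmult_le_compat_l; [repeat apply Rmult_le_pos; lra|].
destruct j as [|m]; [apply Rlt_le, exp_pos|].
apply exp_ge_taylor, Rmult_le_pos; lra.
Qed.

End BlockBounds.

Lemma Cmod_Cexp_power (s a : R) (z : C) :
  0 < s -> Cmod (Cexp (RtoC a * z)%C) = Rpower (exp (- (fst z / s))) (- (s * a)).
Proof.
intros Hs; rewrite Cmod_Cexp; unfold Rpower; rewrite ln_exp; f_equal; simpl; field; lra.
Qed.

Lemma cos_strip (s gamma x : R) :
  0 < gamma < s -> Rabs x < gamma * PI / 2 -> cos (gamma * PI / (2 * s)) <= cos (x / s).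
Proof.
intros Hg Hx; pose proof PI_RGT_0 as HPI.
assert (H1 : Rabs (x / s) <= gamma * PI / (2 * s)).
{ unfold Rdiv; rewrite Rabs_mult, (Rabs_pos_eq (/ s)) by (apply Rlt_le, Rinv_0_lt_compat; lra).
  replace (gamma * PI * / (2 * s)) with (gamma * PI / 2 * / s) by (field; lra).
  apply Rmult_le_compat_r; [apply Rlt_le, Rinv_0_lt_compat; lra|lra]. }
assert (H2 : gamma * PI / (2 * s) <= PI).
{ apply Rmult_le_reg_r with (2 * s); [lra|].
  unfold Rdiv; rewrite Rmult_assoc, Rinv_l by lra; nra. }
replace (cos (x / s)) with (cos (Rabs (x / s)))
  by (unfold Rabs; destruct Rcase_abs; [apply cos_neg|trivial]).
pose proof (Rabs_pos (x / s)); apply cos_decr_1; lra.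
Qed.

(** This is where gamma < s is decisive: the argument of x stays away from PI / 2. *)
Lemma cos_strip_pos (s gamma : R) :
  0 < gamma < s -> 0 < cos (gamma * PI / (2 * s)) <= 1.
Proof.
intros Hg; pose proof PI_RGT_0 as HPI; split; [|apply COS_bound].
assert (H1 : 0 < gamma * PI / (2 * s)).
{ apply Rdiv_lt_0_compat; [apply Rmult_lt_0_compat|]; lra. }
assert (H2 : gamma * PI / (2 * s) < PI / 2).
{ apply Rmult_lt_reg_r with (2 * s); [lra|].
  unfold Rdiv at 1; rewrite Rmult_assoc, Rinv_l by lra; nra. }
apply cos_gt_0; lra.
Qed.

Lemma geo_exp_S : geo (fun n _ => exp (INR (S n))).
Proof.
apply (geo_le _ (fun n _ => exp 1 ^ S n)); [|apply geo_pow_lS, Rlt_le, exp_pos].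
intros n _; split; [apply Rlt_le, exp_pos|right].
rewrite <- Rpower_pow by apply exp_pos; unfold Rpower; rewrite ln_exp; f_equal; ring.
Qed.

Lemma geo_pow_mul (c : R) (L : nat) : 0 <= c -> geo (fun n _ => c ^ (L * n)).
Proof.
intros Hc; apply (geo_le _ (fun n _ => (c ^ L) ^ n)); [|now apply geo_pow_l, pow_le].
intros n _; split; [now apply pow_le|right; apply pow_mult].
Qed.

(** The [Theta] part and the tail are bounded separately, with |v^(n-j)| = y^(-s (n-j)). For [Theta]
    both of its bounds are balanced with exponent q = s (n - j). In the tail, y^(s j) is absorbed by
    exponential decay and y^(-s n) is balanced against y^p / p!. *)
Lemma Phi_bound_pointwise (s delta : R) (n p j : nat) (z : C) :
  0 < s -> s * INR n <= INR p -> 0 < delta <= 1 -> delta <= cos (snd z / s) ->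
  Cmod (Phi s n p j z) <=
  2 ^ (n + p + j) *
  ((exp (INR (S n)) + (2 / delta) ^ p) * exp s ^ S n +
   INR p * (1 + 3 / s) ^ j * (3 / delta) ^ j * Rpower (s / (delta / 3)) s ^ j *
   ((exp (INR (S n)) + (3 / delta) ^ p) * exp s ^ S n)) *
  (INR (fact j) * Rpower (INR (fact j) / INR (fact n)) s).
Proof.
intros Hs Hp Hdelta Hcos.
pose proof (INR_fact_lt_0 n) as Fn; pose proof (INR_fact_lt_0 j) as Fj.
pose proof (INR_fact_lt_0 p) as Fp; pose proof (INR_fact_lt_0 (n + p)) as Fnp.
set (y := exp (- (fst z / s))).
assert (Hy : 0 < y) by apply exp_pos.
(* The decay e^(- delta y) is cut in three: one third pays for the powers inside the tail, one for
   y^(s j), one for y^p / p!. *)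
set (eps := delta / 3) in *.
assert (Heps : 0 < eps <= 1) by (unfold eps; lra).
assert (Eeps : 3 / delta = / eps) by (unfold eps; field; lra).
rewrite Eeps.
set (R1 := INR (fact (n + p + j)) / INR (fact (n + p))).
assert (HR : 0 <= R1 <= 2 ^ (n + p + j) * INR (fact j)).
{ unfold R1; split; [apply Rdiv_le_0_compat; [apply pos_INR|trivial]|].
  apply Rmult_le_reg_r with (INR (fact (n + p))); trivial.
  unfold Rdiv; rewrite Rmult_assoc, Rinv_l, Rmult_1_r by lra.
  pose proof (fact_plus_le (n + p) j); lra. }
set (V := Rpower (INR (fact j) / INR (fact n)) s).
assert (HV : 0 <= V) by apply Rpower_nonneg.
set (G1 := (exp (INR (S n)) + (2 / delta) ^ p) * exp s ^ S n).
set (G2 := (exp (INR (S n)) + (/ eps) ^ p) * exp s ^ S n).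
assert (Hes : 0 <= exp s ^ S n) by (apply pow_le, Rlt_le, exp_pos).
assert (Hie : 0 < / eps) by (apply Rinv_0_lt_compat; lra).
assert (H2d : 0 < 2 / delta) by (apply Rdiv_lt_0_compat; lra).
pose proof (exp_pos (INR (S n))) as HeS.
pose proof (pow_lt _ p Hie) as Hiep; pose proof (pow_lt _ p H2d) as H2dp.
assert (HG1 : 0 <= G1) by (apply Rmult_le_pos; lra).
assert (HG2 : 0 <= G2) by (apply Rmult_le_pos; lra).
unfold Phi; rewrite Cmod_mult, (Cmod_Cexp_power s) by trivial; fold y.
set (P := Rpower y (- (s * (INR n - INR j)))).
assert (HP : 0 <= P) by apply Rpower_nonneg.
apply Rle_trans with
  (P * (Rabs (falling n j) * Cmod (Theta s p z)) + P * Cmod (Phi_tail s n p j z)).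
{ rewrite <- Rmult_plus_distr_l; apply Rmult_le_compat_l; trivial.
  eapply Rle_trans; [apply Cmod_triangle|]; rewrite Cmod_mult, Cmod_R; lra. }
set (Q := INR p * (1 + 3 / s) ^ j * (/ eps) ^ j * Rpower (s / eps) s ^ j).
assert (H3s : 0 < 3 / s) by (apply Rdiv_lt_0_compat; lra).
assert (HQ : 0 <= Q).
{ unfold Q; repeat apply Rmult_le_pos; try apply pow_le; try lra;
    [apply pos_INR|apply Rpower_nonneg]. }
replace (2 ^ (n + p + j) * (G1 + Q * G2) * (INR (fact j) * V)) with
  (2 ^ (n + p + j) * INR (fact j) * (G1 * V) +
   2 ^ (n + p + j) * INR (fact j) * (Q * (G2 * V))) by ring.
apply Rplus_le_compat.
- apply Rle_trans with (R1 * (G1 * V)).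
  2:{ apply Rmult_le_compat_r; [now apply Rmult_le_pos|lra]. }
  (* Balancing needs a nonnegative exponent n - j; for j > n the falling factorial is zero. *)
  destruct (le_lt_dec j n) as [Hj|Hj].
  2:{ rewrite falling_zero, Rabs_R0, Rmult_0_l, Rmult_0_r by trivial.
      apply Rmult_le_pos; [lra|now apply Rmult_le_pos]. }
  replace (P * (Rabs (falling n j) * Cmod (Theta s p z))) with
    (Rabs (falling n j) * (P * Cmod (Theta s p z))) by ring.
  apply Rmult_le_compat; [apply Rabs_pos| |apply falling_bound|].
  { apply Rmult_le_pos; trivial; apply Cmod_ge_0. }
  assert (Hjn : INR j <= INR n) by now apply le_INR.
  pose proof (pos_INR j).
  eapply Rle_trans; [apply (Rpower_mult_le_min y _ 1 ((2 / delta) ^ p) _ n p)|];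
    trivial; try lra.
  + apply Cmod_ge_0.
  + split; nra.
  + rewrite Rmult_1_l; apply (Theta_bound_small s Hs z delta); trivial.
  + apply (Theta_bound_large s Hs z delta); trivial.
  + unfold G1; rewrite Rmult_1_l, Rmult_assoc; apply Rmult_le_compat_l; [lra|].
    replace (- (s * (INR n - INR j))) with (s * (INR j - INR n)) by ring.
    apply Rpower_S_le_fact; lra.
- apply Rle_trans with (R1 * (Q * (G2 * V))).
  2:{ apply Rmult_le_compat_r; [apply Rmult_le_pos; [trivial|now apply Rmult_le_pos]|lra]. }
  apply Rle_trans with (P * (INR p / INR (fact p) * (1 + 3 / s) ^ j * R1 *
    ((/ eps) ^ j * y ^ p * exp (eps * y - delta * y)))).
  { apply Rmult_le_compat_l; trivial; now apply Phi_tail_bound. }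
  replace (eps * y - delta * y) with (- (eps * y) + - (eps * y)) by (unfold eps; field).
  rewrite exp_plus.
  assert (EP : P = Rpower y (s * INR j) * Rpower y (- (s * INR n))).
  { unfold P; rewrite <- Rpower_plus; f_equal; ring. }
  rewrite EP.
  set (E := exp (- (eps * y))).
  replace (Rpower y (s * INR j) * Rpower y (- (s * INR n)) *
    (INR p / INR (fact p) * (1 + 3 / s) ^ j * R1 * ((/ eps) ^ j * y ^ p * (E * E)))) with
    (R1 * (INR p * (1 + 3 / s) ^ j * (/ eps) ^ j) *
      ((Rpower y (s * INR j) * E) *
       (Rpower y (- (s * INR n)) * (y ^ p / INR (fact p) * E)))) by (field; lra).
  replace (R1 * (Q * (G2 * V))) with
    (R1 * (INR p * (1 + 3 / s) ^ j * (/ eps) ^ j) *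
      (Rpower (s / eps) s ^ j * (G2 * V))) by (unfold Q; ring).
  apply Rmult_le_compat_l.
  { apply Rmult_le_pos; [lra|]; repeat apply Rmult_le_pos; try apply pow_le; try lra.
    apply pos_INR. }
  (* Splits off (j!)^s, supplied by the decay; the remaining (0! / n!)^s is the case j = 0 of
     [Rpower_S_le_fact]. *)
  assert (EV : V = Rpower (INR (fact j)) s * Rpower (INR (fact 0) / INR (fact n)) s).
  { unfold V; rewrite Rpower_mult_distr; trivial.
    - f_equal; simpl; field; lra.
    - simpl; apply Rdiv_lt_0_compat; lra. }
  rewrite EV.
  replace (Rpower (s / eps) s ^ j * (G2 * (Rpower (INR (fact j)) s *
    Rpower (INR (fact 0) / INR (fact n)) s))) with
    ((Rpower (s / eps) s ^ j * Rpower (INR (fact j)) s) *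
     (G2 * Rpower (INR (fact 0) / INR (fact n)) s)) by ring.
  assert (HE : 0 < E) by apply exp_pos.
  assert (HE1 : E <= 1).
  { unfold E; rewrite <- exp_0; apply exp_monotone; nra. }
  pose proof (pow_lt y p Hy) as Hyp.
  assert (Hyf : 0 <= y ^ p / INR (fact p)) by (apply Rdiv_le_0_compat; lra).
  apply Rmult_le_compat.
  + apply Rmult_le_pos; [apply Rpower_nonneg|lra].
  + apply Rmult_le_pos; [apply Rpower_nonneg|]; apply Rmult_le_pos; lra.
  + apply Rpower_exp_decay; lra.
  + pose proof (pos_INR n).
    eapply Rle_trans; [apply (Rpower_mult_le_min y _ 1 ((/ eps) ^ p) _ n p)|];
      trivial; try lra.
    * apply Rmult_le_pos; lra.
    * split; [apply Rmult_le_pos; lra|lra].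
    * nra.
    * apply pow_div_fact_decay; lra.
    * unfold G2; rewrite Rmult_1_l, Rmult_assoc; apply Rmult_le_compat_l; [lra|].
      replace (- (s * INR n)) with (s * (INR 0 - INR n)) by (simpl; ring).
      apply Rpower_S_le_fact; lra.
Qed.

(** With p = L n, all factors of the pointwise bound are geometric in n and j, so a single base
    serves for all n, j and z. *)
Lemma Phi_bound (s gamma : R) (L : nat) :
  0 < gamma < s -> s <= INR L ->
  exists B, 1 <= B /\ forall n j z, Rabs (snd z) < gamma * PI / 2 ->
    Cmod (Phi s n (L * n) j z) <=
    B ^ S (n + j) * (INR (fact j) * Rpower (INR (fact j) / INR (fact n)) s).
Proof.
intros Hg HL.
destruct (cos_strip_pos s gamma Hg) as [Hd0 Hd1].
set (delta := cos (gamma * PI / (2 * s))) in *.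
assert (Hs : 0 < s) by lra.
assert (H3s : 0 < 3 / s) by (apply Rdiv_lt_0_compat; lra).
assert (H3d : 0 < 3 / delta) by (apply Rdiv_lt_0_compat; lra).
assert (H2d : 0 < 2 / delta) by (apply Rdiv_lt_0_compat; lra).
pose proof (exp_pos s) as Hes.
assert (HG : geo (fun n j => 2 ^ (n + L * n + j) *
  ((exp (INR (S n)) + (2 / delta) ^ (L * n)) * exp s ^ S n +
   INR (L * n) * (1 + 3 / s) ^ j * (3 / delta) ^ j * Rpower (s / (delta / 3)) s ^ j *
   ((exp (INR (S n)) + (3 / delta) ^ (L * n)) * exp s ^ S n)))).
{ apply geo_mult; [|apply geo_plus].
  - apply (geo_le _ (fun n j => (2 ^ n * 2 ^ (L * n)) * 2 ^ j)).
    + intros n j; rewrite !pow_add; split; [|lra].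
      repeat apply Rmult_le_pos; apply pow_le; lra.
    + apply (geo_mult (fun n _ => 2 ^ n * 2 ^ (L * n)) (fun _ j => 2 ^ j));
        [|apply geo_pow_r; lra].
      apply (geo_mult (fun n _ => 2 ^ n) (fun n _ => 2 ^ (L * n)));
        [apply geo_pow_l|apply geo_pow_mul]; lra.
  - apply (geo_mult (fun n _ => exp (INR (S n)) + (2 / delta) ^ (L * n))
      (fun n _ => exp s ^ S n)); [|apply geo_pow_lS; lra].
    apply (geo_plus (fun n _ => exp (INR (S n))) (fun n _ => (2 / delta) ^ (L * n)));
      [apply geo_exp_S|apply geo_pow_mul; lra].
  - apply geo_mult; [repeat apply geo_mult|].
    + apply (geo_le _ (fun n _ => 2 ^ (L * n))); [|apply geo_pow_mul; lra].
      intros n _; split; [apply pos_INR|].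
      generalize (L * n)%nat; intros m; induction m as [|m IH]; [simpl; lra|].
      rewrite S_INR; simpl pow; pose proof (pow_R1_Rle 2 m); lra.
    + apply geo_pow_r; lra.
    + apply geo_pow_r; lra.
    + apply geo_pow_r, Rpower_nonneg.
    + apply (geo_mult (fun n _ => exp (INR (S n)) + (3 / delta) ^ (L * n))
        (fun n _ => exp s ^ S n)); [|apply geo_pow_lS; lra].
      apply (geo_plus (fun n _ => exp (INR (S n))) (fun n _ => (3 / delta) ^ (L * n)));
        [apply geo_exp_S|apply geo_pow_mul; lra]. }
destruct HG as [B [HB HG]]; exists B; split; trivial; intros n j z Hz.
eapply Rle_trans; [apply (Phi_bound_pointwise s delta)|]; trivial; try lra.
- rewrite mult_INR; pose proof (pos_INR n); nra.
- now apply cos_strip.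
- apply Rmult_le_compat_r; [|apply HG].
  apply Rmult_le_pos; [apply pos_INR|apply Rpower_nonneg].
Qed.

(** * Limits at the vertex *)

(* In the coordinate z = log v the vertex is at Re z = - oo, and exp (fst z) = |v|. *)
Definition flat_bounded (width : R) (f : C -> C) : Prop :=
  exists K, forall z, Rabs (snd z) < width -> fst z <= 0 -> Cmod (f z) <= K * exp (fst z).

Lemma flat_bounded_ext (width : R) (f g : C -> C) :
  (forall z, f z = g z) -> flat_bounded width f -> flat_bounded width g.
Proof. intros E [K H]; exists K; intros z; rewrite <- E; apply H. Qed.

Lemma flat_bounded_zero (width : R) : flat_bounded width (fun _ => 0%C).
Proof. exists 0; intros; rewrite Cmod_0; lra. Qed.

Lemma flat_bounded_plus (width : R) (f g : C -> C) :
  flat_bounded width f -> flat_bounded width g -> flat_bounded width (fun z => f z + g z)%C.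
Proof.
intros [K Hf] [K' Hg]; exists (K + K'); intros z H1 H2.
eapply Rle_trans; [apply Cmod_triangle|].
specialize (Hf z H1 H2); specialize (Hg z H1 H2); lra.
Qed.

Lemma flat_bounded_scal (width : R) (k : C) (f : C -> C) :
  flat_bounded width f -> flat_bounded width (fun z => k * f z)%C.
Proof.
intros [K Hf]; exists (Cmod k * K); intros z H1 H2; rewrite Cmod_mult, Rmult_assoc.
apply Rmult_le_compat_l; [apply Cmod_ge_0|auto].
Qed.

Section Vertex.

Context (s gamma : R) (Hg : 0 < gamma < s).

Lemma flat_bounded_xexp (a : R) (k : nat) :
  flat_bounded (gamma * PI / 2) (fun z => Cexp (RtoC a * z) * xexp s k z)%C.
Proof.
destruct (cos_strip_pos s gamma Hg) as [Hd0 Hd1].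
set (delta := cos (gamma * PI / (2 * s))) in *.
(* Since exp (fst z) = y^(-s), the power of y to be beaten by e^(- delta y) is k - s a + s; as y >=
   1, an integer m above it suffices. *)
destruct (INR_unbounded (INR k + s * (1 - a))) as [m Hm].
exists ((/ delta) ^ m * INR (fact m)); intros z Hz Hz0.
rewrite Cmod_mult, (Cmod_Cexp_power s) by lra.
set (y := exp (- (fst z / s))).
assert (Hy : 1 <= y).
{ unfold y; rewrite <- exp_0; apply exp_monotone.
  assert (0 <= - fst z / s) by (apply Rdiv_le_0_compat; lra).
  unfold Rdiv in *; lra. }
assert (Ez : exp (fst z) = Rpower y (- s)).
{ unfold Rpower, y; rewrite ln_exp; f_equal; field; lra. }
rewrite Ez.
apply Rle_trans with (Rpower y (- (s * a)) * (y ^ k * exp (- (delta * y)))).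
{ apply Rmult_le_compat_l; [apply Rpower_nonneg|].
  apply Cmod_xexp; [lra|now apply cos_strip]. }
rewrite <- (Rpower_pow k) by lra.
rewrite <- Rmult_assoc, <- Rpower_plus.
apply Rmult_le_reg_r with (Rpower y s * exp (delta * y)).
{ apply Rmult_lt_0_compat; apply exp_pos. }
replace (Rpower y (- (s * a) + INR k) * exp (- (delta * y)) * (Rpower y s * exp (delta * y)))
  with (Rpower y (- (s * a) + INR k + s) * exp (- (delta * y) + delta * y))
  by (rewrite exp_plus, (Rpower_plus _ s); ring).
replace ((/ delta) ^ m * INR (fact m) * Rpower y (- s) * (Rpower y s * exp (delta * y)))
  with ((/ delta) ^ m * INR (fact m) * exp (delta * y) * Rpower y (- s + s))
  by (rewrite Rpower_plus; ring).
rewrite !Rplus_opp_l, exp_0, Rpower_O, !Rmult_1_r by lra.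
apply Rle_trans with (y ^ m).
- rewrite <- Rpower_pow by lra; apply Rle_Rpower; lra.
- apply pow_le_fact_exp_scaled; lra.
Qed.

Lemma flat_bounded_Theta (a : R) (q : nat) :
  flat_bounded (gamma * PI / 2) (fun z => Cexp (RtoC a * z) * (Theta s q z - 1))%C.
Proof.
induction q as [|q IH].
- apply (flat_bounded_ext _ (fun _ => 0%C)); [intros z; simpl; ring|apply flat_bounded_zero].
- eapply flat_bounded_ext; [|apply (flat_bounded_plus _ _ _ IH
    (flat_bounded_scal _ (- RtoC (/ INR (fact q)))%C _ (flat_bounded_xexp a q)))].
  intros z; simpl; ring.
Qed.

Lemma flat_bounded_Phi_tail (a : R) (n p j : nat) :
  flat_bounded (gamma * PI / 2) (fun z => Cexp (RtoC a * z) * Phi_tail s n p j z)%C.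
Proof.
unfold Phi_tail.
assert (H : forall m, flat_bounded (gamma * PI / 2) (fun z => Cexp (RtoC a * z) *
  psum (fun i => RtoC (tail_coef s n p j i / INR (fact i)) * xexp s (p + i) z) m)%C);
  [|apply H].
induction m as [|m IH].
- apply (flat_bounded_ext _ (fun _ => 0%C)); [intros z; simpl; ring|apply flat_bounded_zero].
- eapply flat_bounded_ext; [|apply (flat_bounded_plus _ _ _ IH (flat_bounded_scal _
    (RtoC (tail_coef s n p j m / INR (fact m))) _ (flat_bounded_xexp a (p + m))))].
  intros z; simpl; ring.
Qed.

Lemma falling_fact (n j : nat) :
  (j <= n)%nat -> falling n j * INR (fact (n - j)) = INR (fact n).
Proof.
induction j as [|j IH]; intros Hj; [rewrite Nat.sub_0_r; simpl; ring|].
rewrite <- IH by lia; replace (n - j)%nat with (S (n - S j)) by lia.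
rewrite fact_simpl, mult_INR; simpl falling.
rewrite <- minus_INR by lia; replace (S (n - S j)) with (n - j)%nat by lia; ring.
Qed.

(** Up to flat terms, this is the j-th derivative of v^n: the constant n! for j = n, O(v) for j < n
    and 0 for j > n. *)
Lemma flat_bounded_Phi (n p j : nat) :
  flat_bounded (gamma * PI / 2)
    (fun z => Phi s n p j z - if Nat.eqb n j then RtoC (INR (fact n)) else 0)%C.
Proof.
assert (H : flat_bounded (gamma * PI / 2) (fun z =>
  Cexp (RtoC (INR n - INR j) * z) * RtoC (falling n j)
  - if Nat.eqb n j then RtoC (INR (fact n)) else 0)%C).
{ destruct (Nat.eqb_spec n j) as [<-|Hne].
  - eapply flat_bounded_ext; [|apply flat_bounded_zero]; intros z; simpl.
    replace (RtoC (INR n - INR n) * z)%C with (RtoC 0) by (rewrite Rminus_diag; ring).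
    pose proof (falling_fact n n (le_n n)) as E; rewrite Nat.sub_diag in E; simpl in E.
    rewrite Rmult_1_r in E; rewrite E, Cexp_0; ring.
  - destruct (le_lt_dec j n) as [Hj|Hj].
    + exists (Rabs (falling n j)); intros z _ Hz.
      replace (Cexp (RtoC (INR n - INR j) * z) * RtoC (falling n j) - 0)%C
        with (RtoC (falling n j) * Cexp (RtoC (INR n - INR j) * z))%C by ring.
      rewrite Cmod_mult, Cmod_R, Cmod_Cexp.
      apply Rmult_le_compat_l; [apply Rabs_pos|]; apply exp_monotone.
      assert (H1 : INR j + 1 <= INR n) by (rewrite <- S_INR; apply le_INR; lia).
      simpl; nra.
    + eapply flat_bounded_ext; [|apply flat_bounded_zero]; intros z; simpl.
      rewrite falling_zero by trivial; ring. }
eapply flat_bounded_ext; [|apply (flat_bounded_plus _ _ _ (flat_bounded_plus _ _ _ H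
  (flat_bounded_scal _ (RtoC (falling n j)) _ (flat_bounded_Theta (INR n - INR j) p)))
  (flat_bounded_Phi_tail (INR n - INR j) n p j))].
intros z; unfold Phi; cbv beta; destruct Nat.eqb; ring.
Qed.

End Vertex.

(** Each term is only assumed to tend to its limit at a rate depending on n. Integrating the next
    derivative along the horizontal half-line from Re z = - oo to z makes the rate uniform: the
    integrand is at most K_(j+1) 2^(-n) e^(Re w). *)
Lemma Csum_limit (width : R) (u : nat -> nat -> C -> C) (K : nat -> R) (l : nat -> C) :
  (forall n j z, Rabs (snd z) < width -> Cderive (u n j) z (Cexp z * u n (S j) z)%C) ->
  (forall j z, Rabs (snd z) < width -> geom_bounded (fun n => u n j z) (K j)) ->
  (forall n j, exists C r, forall z, Rabs (snd z) < width -> fst z <= r ->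
     Cmod (u n j z - if Nat.eqb n j then l j else 0)%C <= C * exp (fst z)) ->
  forall j z, Rabs (snd z) < width ->
    Cmod (Csum (fun n => u n j z) - l j)%C <= 4 * (K (S j) * exp (fst z)).
Proof.
intros Hd Hb Hl j z Hz.
set (v := fun n => (u n j z + - (1) * (if Nat.eqb n j then l j else 0))%C).
assert (Hv : geom_bounded v (K (S j) * exp (fst z))).
{ intros n; unfold v; apply le_epsilon; intros eps Heps.
  destruct (Hl n j) as [C [r HC]].
  set (D := Rabs C * exp (fst z)).
  assert (HD : 0 <= D) by (apply Rmult_le_pos; [apply Rabs_pos|apply Rlt_le, exp_pos]).
  (* The half-line is cut at z - t: far enough left to apply the termwise limit, and with endpoint
     error D e^(-t) <= eps because D <= eps t <= eps e^t. *)
  set (t := Rmax (fst z - r) (D / eps)).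
  assert (Ht1 : fst z - t <= r) by (pose proof (Rmax_l (fst z - r) (D / eps)); unfold t; lra).
  assert (Ht2 : D <= eps * t).
  { apply Rle_trans with (eps * (D / eps)); [right; field; lra|].
    apply Rmult_le_compat_l; [lra|apply Rmax_r]. }
  assert (Ht : 0 <= t) by nra.
  assert (Es : forall x : R, snd (z + RtoC x)%C = snd z) by (intros x; simpl; ring).
  assert (Ez : (z + RtoC (- t) + RtoC t)%C = z) by (rewrite RtoC_opp; ring).
  replace (u n j z + - (1) * (if Nat.eqb n j then l j else 0))%C with
    ((u n j (z + RtoC (- t) + RtoC t) - u n j (z + RtoC (- t))) +
     (u n j (z + RtoC (- t)) - if Nat.eqb n j then l j else 0))%C by (rewrite Ez; ring).
  eapply Rle_trans; [apply Cmod_triangle|]; apply Rplus_le_compat.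
  - set (k := K (S j) * (/ 2) ^ n).
    apply Rle_trans with (k * exp (fst z - t + t * 1) - k * exp (fst z - t + t * 0)).
    + apply (Cderive_increment_le (u n j) (fun w => Cexp w * u n (S j) w)%C _ _
        (fun x => k * exp (fst z - t + t * x)) (fun x => k * (t * exp (fst z - t + t * x)))).
      * intros x _; apply Hd.
        rewrite <- RtoC_mult, <- Cplus_assoc, <- RtoC_plus, Es; trivial.
      * intros x _; auto_derive; [trivial|unfold Rminus; ring].
      * intros x Hx; rewrite <- RtoC_mult, <- Cplus_assoc, <- RtoC_plus.
        rewrite !Cmod_mult, Cmod_R, Cmod_Cexp, Rabs_pos_eq by trivial.
        replace (fst (z + RtoC (- t + x * t))%C) with (fst z - t + t * x) by (simpl; ring).
        pose proof (Hb (S j) (z + RtoC (- t + x * t))%C) as B; rewrite Es in B.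
        specialize (B Hz n); simpl in B; fold k in B.
        replace (k * (t * exp (fst z - t + t * x))) with (t * (exp (fst z - t + t * x) * k)) by ring.
        repeat apply Rmult_le_compat_l; trivial; apply Rlt_le, exp_pos.
    + assert (Hk : 0 <= k) by exact (Rle_trans _ _ _ (Cmod_ge_0 _) (Hb (S j) z Hz n)).
      replace (fst z - t + t * 1) with (fst z) by ring.
      pose proof (exp_pos (fst z - t + t * 0)); unfold k in *; nra.
  - eapply Rle_trans; [apply HC|].
    + now rewrite Es.
    + simpl; lra.
    + replace (fst (z + RtoC (- t))%C) with (fst z + - t) by (simpl; ring).
      rewrite exp_plus.
      apply Rle_trans with (D * exp (- t)).
      { unfold D; rewrite <- Rmult_assoc; apply Rmult_le_compat_r; [apply Rlt_le, exp_pos|].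
        apply Rmult_le_compat_r; [apply Rlt_le, exp_pos|apply Rle_abs]. }
      apply Rmult_le_reg_r with (exp t); [apply exp_pos|].
      rewrite Rmult_assoc, <- exp_plus, Rplus_opp_l, exp_0, Rmult_1_r.
      pose proof (exp_ineq1_le t); nra. }
assert (E : Csum v = (Csum (fun n => u n j z) - l j)%C).
{ unfold v.
  (* The factor 2^j compensates the weight 2^(-j) at the only nonzero index. *)
  assert (Hs : geom_bounded (fun n => if Nat.eqb n j then l j else 0%C) (Cmod (l j) * 2 ^ j)).
  { intros n; destruct (Nat.eqb_spec n j) as [->|].
    - rewrite Rmult_assoc, <- Rpow_mult_distr, Rinv_r, pow1 by lra; lra.
    - rewrite Cmod_0; repeat apply Rmult_le_pos; try apply pow_le; try lra; apply Cmod_ge_0. }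
  rewrite (Csum_plus _ _ _ _ (Hb j z Hz) (geom_bounded_scal (- (1))%C _ _ Hs)).
  rewrite (Csum_scal _ _ _ Hs), Csum_single; ring. }
rewrite <- E; now apply geom_bounded_series.
Qed.

(** * Consequences of the growth index for M *)

Lemma strongly_regular_pos (M : nat -> R) : strongly_regular M -> forall j, 0 < M j.
Proof.
intros [A [_ [[H0 H1] _]]]; induction j as [|j IH]; [lra|].
exact (Rlt_le_trans _ _ _ IH (H1 j)).
Qed.

Lemma property_P_of_lt_growth_index (M : nat -> R) (gamma : R) :
  0 < gamma -> Rbar_lt (Finite gamma) (growth_index M) ->
  exists s, gamma < s /\ property_P s M.
Proof.
intros Hg H; apply NNPP; intros Hn.
apply (Rbar_lt_not_le _ _ H).
apply (proj2 (Lub_Rbar_correct (fun g => 0 < g /\ property_P g M))).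
intros x [Hx HP]; simpl; apply Rnot_lt_le; intros Hl; apply Hn; now exists x.
Qed.

(* M_j / M_n >= a^(-|j - n|) (j! / n!)^s mu_n^(j - n), written without negative
   exponents: around each index n the sequence M dominates a Gevrey sequence of
   order s, rescaled by mu_n. *)
Lemma property_P_gevrey_minorant (M : nat -> R) (s : R) :
  (forall j, 0 < M j) -> property_P s M ->
  exists a (mu : nat -> R), 1 <= a /\ (forall n, 0 < mu n) /\
    forall n j, M n * mu n ^ j * Rpower (INR (fact j) / INR (fact n)) s
                <= a ^ (n + j) * M j * mu n ^ n.
Proof.
intros HM [m' [a [Ha [Hinc Hm]]]].
(* Property (P_s) says exactly that this sequence is nondecreasing, while the quotient of index i is
   (i+1)^s mu_i up to a factor a. *)
set (mu := fun n => Rpower (INR (S n)) (- s) * m' n).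
assert (Hq : forall n, M (S n) = quotients M n * M n).
{ intros n; unfold quotients; field; apply Rgt_not_eq, HM. }
assert (Hq0 : forall n, 0 < quotients M n).
{ intros n; apply Rdiv_lt_0_compat; apply HM. }
assert (Hia : 0 < / a) by (apply Rinv_0_lt_compat; lra).
assert (Hm0 : forall n, 0 < m' n).
{ intros n; eapply Rlt_le_trans; [|apply Hm]; now apply Rmult_lt_0_compat. }
assert (Hmu : forall n, 0 < mu n).
{ intros n; apply Rmult_lt_0_compat; [apply exp_pos|apply Hm0]. }
assert (Hmono : forall i k, mu i <= mu (i + k)%nat).
{ intros i k; induction k as [|k IH]; [rewrite Nat.add_0_r; lra|].
  rewrite Nat.add_succ_r; apply (Rle_trans _ _ _ IH), Hinc. }
assert (Em : forall n, m' n = Rpower (INR (S n)) s * mu n).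
{ intros n; unfold mu; rewrite <- Rmult_assoc, <- Rpower_plus, Rplus_opp_r.
  rewrite Rpower_O by (apply lt_0_INR; lia); ring. }
assert (Hlow : forall n, Rpower (INR (S n)) s * mu n <= a * quotients M n).
{ intros n; rewrite <- Em; apply Hm. }
assert (Hup : forall n, quotients M n <= a * (Rpower (INR (S n)) s * mu n)).
{ intros n; rewrite <- Em; apply Rmult_le_reg_l with (/ a); trivial.
  rewrite <- Rmult_assoc, Rinv_l, Rmult_1_l by lra; apply Hm. }
assert (Hfact : forall i, Rpower (INR (fact (S i))) s
  = Rpower (INR (S i)) s * Rpower (INR (fact i)) s).
{ intros i; rewrite fact_simpl, mult_INR, Rpower_mult_distr; trivial;
    [apply lt_0_INR; lia|apply INR_fact_lt_0]. }
(* M_(n+k) / M_n is a product of quotients of index i >= n, each at least (i+1)^s mu_n / a. *)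
assert (Hup' : forall n k,
  M n * mu n ^ k * Rpower (INR (fact (n + k))) s
  <= a ^ k * M (n + k)%nat * Rpower (INR (fact n)) s).
{ intros n k; induction k as [|k IH]; [rewrite Nat.add_0_r; simpl; lra|].
  rewrite Nat.add_succ_r, Hq, Hfact.
  apply Rle_trans with
    ((Rpower (INR (S (n + k))) s * mu n) * (a ^ k * M (n + k)%nat * Rpower (INR (fact n)) s)).
  - simpl pow.
    replace (M n * (mu n * mu n ^ k) *
      (Rpower (INR (S (n + k))) s * Rpower (INR (fact (n + k))) s))
      with ((Rpower (INR (S (n + k))) s * mu n) *
        (M n * mu n ^ k * Rpower (INR (fact (n + k))) s)) by ring.
    apply Rmult_le_compat_l; trivial.
    apply Rmult_le_pos; [apply Rpower_nonneg|apply Rlt_le, Hmu].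
  - replace (a ^ S k * (quotients M (n + k) * M (n + k)%nat) * Rpower (INR (fact n)) s)
      with ((a * quotients M (n + k)) * (a ^ k * M (n + k)%nat * Rpower (INR (fact n)) s))
      by (simpl; ring).
    apply Rmult_le_compat_r.
    + apply Rmult_le_pos; [|apply Rpower_nonneg].
      apply Rmult_le_pos; [apply pow_le; lra|apply Rlt_le, HM].
    + eapply Rle_trans; [|apply Hlow].
      apply Rmult_le_compat_l; [apply Rpower_nonneg|apply Hmono]. }
(* Below n the monotonicity of mu works the other way: each quotient of index i < n is at most a
   (i+1)^s mu_n. *)
assert (Hdown : forall n j k, (j + k <= n)%nat ->
  M (j + k)%nat * Rpower (INR (fact j)) s
  <= a ^ k * M j * mu n ^ k * Rpower (INR (fact (j + k))) s).
{ intros n j k; induction k as [|k IH]; intros Hk; [rewrite Nat.add_0_r; simpl; lra|].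
  specialize (IH ltac:(lia)).
  rewrite Nat.add_succ_r, Hq, Hfact.
  assert (Hmn : mu (j + k)%nat <= mu n).
  { replace n with (j + k + (n - (j + k)))%nat by lia; apply Hmono. }
  apply Rle_trans with ((a * (Rpower (INR (S (j + k))) s * mu n)) *
    (M (j + k)%nat * Rpower (INR (fact j)) s)).
  - rewrite Rmult_assoc; apply Rmult_le_compat_r.
    + apply Rmult_le_pos; [apply Rlt_le, HM|apply Rpower_nonneg].
    + eapply Rle_trans; [apply Hup|].
      apply Rmult_le_compat_l; [lra|]; apply Rmult_le_compat_l; trivial; apply Rpower_nonneg.
  - replace (a ^ S k * M j * mu n ^ S k *
      (Rpower (INR (S (j + k))) s * Rpower (INR (fact (j + k))) s)) with
      ((a * (Rpower (INR (S (j + k))) s * mu n)) *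
        (a ^ k * M j * mu n ^ k * Rpower (INR (fact (j + k))) s)) by (simpl; ring).
    apply Rmult_le_compat_l; trivial.
    apply Rmult_le_pos; [lra|]; apply Rmult_le_pos; [apply Rpower_nonneg|apply Rlt_le, Hmu]. }
exists a, mu; repeat split; trivial; intros n j.
assert (Fn := INR_fact_lt_0 n); assert (Fj := INR_fact_lt_0 j).
assert (HR : 0 < Rpower (INR (fact n)) s) by apply exp_pos.
assert (ER : Rpower (INR (fact j) / INR (fact n)) s * Rpower (INR (fact n)) s
  = Rpower (INR (fact j)) s).
{ rewrite Rpower_mult_distr by (trivial; now apply Rdiv_lt_0_compat).
  f_equal; field; lra. }
apply Rmult_le_reg_r with (Rpower (INR (fact n)) s); trivial.
rewrite Rmult_assoc, ER.
pose proof (Hmu n) as Hmn; pose proof (HM j) as HMj.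
destruct (le_lt_dec n j) as [H|H].
- replace j with (n + (j - n))%nat at 1 2 by lia.
  rewrite pow_add.
  apply Rle_trans with (mu n ^ n * (a ^ (j - n) * M (n + (j - n))%nat * Rpower (INR (fact n)) s)).
  + replace (M n * (mu n ^ n * mu n ^ (j - n)) * Rpower (INR (fact (n + (j - n)))) s) with
      (mu n ^ n * (M n * mu n ^ (j - n) * Rpower (INR (fact (n + (j - n)))) s)) by ring.
    apply Rmult_le_compat_l; [now apply Rlt_le, pow_lt|apply Hup'].
  + replace (n + (j - n))%nat with j by lia.
    replace (mu n ^ n * (a ^ (j - n) * M j * Rpower (INR (fact n)) s)) with
      (a ^ (j - n) * (mu n ^ n * M j * Rpower (INR (fact n)) s)) by ring.
    replace (a ^ (n + j) * M j * mu n ^ n * Rpower (INR (fact n)) s) with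
      (a ^ (n + j) * (mu n ^ n * M j * Rpower (INR (fact n)) s)) by ring.
    apply Rmult_le_compat_r; [|apply Rle_pow; [lra|lia]].
    apply Rmult_le_pos; [|lra]; apply Rmult_le_pos; [now apply Rlt_le, pow_lt|lra].
- pose proof (Hdown n j (n - j)%nat ltac:(lia)) as D.
  replace (j + (n - j))%nat with n in D by lia.
  apply Rle_trans with (mu n ^ j *
    (a ^ (n - j) * M j * mu n ^ (n - j) * Rpower (INR (fact n)) s)).
  + replace (M n * mu n ^ j * Rpower (INR (fact j)) s) with
      (mu n ^ j * (M n * Rpower (INR (fact j)) s)) by ring.
    apply Rmult_le_compat_l; [now apply Rlt_le, pow_lt|trivial].
  + replace (mu n ^ j * (a ^ (n - j) * M j * mu n ^ (n - j) * Rpower (INR (fact n)) s)) with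
      (a ^ (n - j) * (M j * mu n ^ (j + (n - j)) * Rpower (INR (fact n)) s))
      by (rewrite pow_add; ring).
    replace (j + (n - j))%nat with n by lia.
    replace (a ^ (n + j) * M j * mu n ^ n * Rpower (INR (fact n)) s) with
      (a ^ (n + j) * (M j * mu n ^ n * Rpower (INR (fact n)) s)) by ring.
    apply Rmult_le_compat_r; [|apply Rle_pow; [lra|lia]].
    apply Rmult_le_pos; [|lra]; apply Rmult_le_pos; [lra|now apply Rlt_le, pow_lt].
Qed.

(** * The extension operator *)

(* The j-th derivative of lambda_n / n! * tau^(-n) * Phi_n(tau * v) at v = e ^ z. *)
Definition ext_term (s : R) (L : nat) (tau : nat -> R) (lambda : nat -> C)
    (n j : nat) (z : C) : C :=
  (lambda n * RtoC (tau n ^ j / (tau n ^ n * INR (fact n))) *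
   Phi s n (L * n) j (z + RtoC (ln (tau n))))%C.

Lemma Cderive_ext_term s L tau lambda n j z :
  0 < s -> 0 < tau n ->
  Cderive (ext_term s L tau lambda n j) z (Cexp z * ext_term s L tau lambda n (S j) z)%C.
Proof.
intros Hs Ht.
eapply Cderive_ext; [| |apply (Cderive_scal (lambda n * RtoC (tau n ^ j / (tau n ^ n * INR (fact n))))%C
  _ z _ (Cderive_comp _ (fun w => 1 * w + RtoC (ln (tau n)))%C z _ _
    (Cderive_Phi s n (L * n) Hs j _) (Cderive_affine 1%C (RtoC (ln (tau n))) z)))].
- intros w; unfold ext_term; do 2 f_equal; ring.
- unfold ext_term.
  replace (1 * z + RtoC (ln (tau n)))%C with (z + RtoC (ln (tau n)))%C by ring.
  rewrite Cexp_plus.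
  replace (Cexp (RtoC (ln (tau n)))) with (RtoC (tau n)).
  2:{ unfold Cexp, RtoC; simpl; rewrite exp_ln, cos_0, sin_0 by trivial; f_equal; ring. }
  replace (RtoC (tau n ^ S j / (tau n ^ n * INR (fact n)))) with
    (RtoC (tau n) * RtoC (tau n ^ j / (tau n ^ n * INR (fact n))))%C; [ring|].
  rewrite <- RtoC_mult; f_equal; unfold Rdiv; simpl; ring.
Qed.

Lemma ext_term_limit s gamma L tau lambda n j :
  0 < gamma < s -> 0 < tau n ->
  exists C r, forall z, Rabs (snd z) < gamma * PI / 2 -> fst z <= r ->
    Cmod (ext_term s L tau lambda n j z - if Nat.eqb n j then lambda j else 0)%C
    <= C * exp (fst z).
Proof.
intros Hg Ht.
destruct (flat_bounded_Phi s gamma Hg n (L * n) j) as [K HK].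
set (c := (lambda n * RtoC (tau n ^ j / (tau n ^ n * INR (fact n))))%C).
(* The threshold puts the shifted point z + ln tau_n in the half-plane Re <= 0; it depends on n, so
   this convergence is not uniform in n. *)
exists (Cmod c * (K * tau n)), (- ln (tau n)); intros z Hz Hr.
pose proof (INR_fact_neq_0 n) as Fn.
assert (E : (ext_term s L tau lambda n j z - (if Nat.eqb n j then lambda j else 0))%C =
  (c * (Phi s n (L * n) j (z + RtoC (ln (tau n))) -
    if Nat.eqb n j then RtoC (INR (fact n)) else 0))%C).
{ unfold ext_term; fold c; destruct (Nat.eqb_spec n j) as [<-|]; [|ring].
  replace (lambda n) with (c * RtoC (INR (fact n)))%C; [ring|].
  unfold c; rewrite <- Cmult_assoc, <- RtoC_mult.
  replace (tau n ^ n / (tau n ^ n * INR (fact n)) * INR (fact n)) with 1; [ring|].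
  field; split; trivial; apply pow_nonzero; lra. }
rewrite E, Cmod_mult, Rmult_assoc; apply Rmult_le_compat_l; [apply Cmod_ge_0|].
eapply Rle_trans; [apply HK|].
- simpl; rewrite Rplus_0_r; exact Hz.
- simpl; lra.
- simpl; rewrite exp_plus, exp_ln by trivial; lra.
Qed.

Section Extension.

Context (M : nat -> R) (s gamma a B sigma : R) (L : nat) (mu : nat -> R)
  (Hg : 0 < gamma < s) (Ha : 1 <= a) (HB : 1 <= B)
  (Hsigma : 0 < sigma) (Hmu : forall n, 0 < mu n)
  (Hminorant : forall n j, M n * mu n ^ j * Rpower (INR (fact j) / INR (fact n)) s
     <= a ^ (n + j) * M j * mu n ^ n)
  (HPhi : forall n j z, Rabs (snd z) < gamma * PI / 2 ->
     Cmod (Phi s n (L * n) j z) <=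
     B ^ S (n + j) * (INR (fact j) * Rpower (INR (fact j) / INR (fact n)) s)).

(** In tau_n^(-n), the factor sigma cancels the growth of lambda_n, a B cancels the geometric losses
    in n, mu_n is the scale of the minorant, and 2 leaves the summable 2^(-n). *)
Let tau (n : nat) : R := 2 * a * B * sigma * mu n.
(** The price in j: (2 a B)^j from tau_n^j, times (a B)^j from the minorant and the block bound. It
    involves neither sigma nor lambda. *)
Let d : R := 2 * (a * B) ^ 2.

Lemma tau_pos n : 0 < tau n.
Proof. unfold tau; repeat apply Rmult_lt_0_compat; trivial; lra. Qed.

(** The n! of the weight cancels the one in the Taylor coefficient, and [Hminorant] trades M_n (j! /
    n!)^s mu_n^j for M_j mu_n^n; the remaining powers combine into 2^(-n) d^j. *)
Lemma ext_term_bound lambda c j z :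
  Lambda_adm M sigma lambda c -> Rabs (snd z) < gamma * PI / 2 ->
  geom_bounded (fun n => ext_term s L tau lambda n j z) (c * B * weight M (d * sigma) j).
Proof.
intros [Hc Hl] Hz n; unfold ext_term.
pose proof (tau_pos n) as Ht; pose proof (INR_fact_lt_0 n) as Fn; pose proof (INR_fact_lt_0 j) as Fj.
pose proof (pow_lt _ j Ht) as Htj; pose proof (pow_lt _ n Ht) as Htn.
assert (Hden : 0 < tau n ^ n * INR (fact n)) by now apply Rmult_lt_0_compat.
assert (Hq : 0 < tau n ^ j / (tau n ^ n * INR (fact n))) by now apply Rdiv_lt_0_compat.
rewrite !Cmod_mult, Cmod_R, Rabs_pos_eq by lra.
set (V := Rpower (INR (fact j) / INR (fact n)) s) in *.
apply Rle_trans with (c * weight M sigma n * (tau n ^ j / (tau n ^ n * INR (fact n))) *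
  (B ^ S (n + j) * (INR (fact j) * V))).
{ apply Rmult_le_compat; [|apply Cmod_ge_0| |].
  - apply Rmult_le_pos; [apply Cmod_ge_0|lra].
  - apply Rmult_le_compat_r; [lra|apply Hl].
  - apply HPhi; simpl; now rewrite Rplus_0_r. }
set (T := 2 * a * B).
assert (HT : 0 < T) by (unfold T; apply Rmult_lt_0_compat; lra).
assert (Hmun := Hmu n).
assert (Et : forall k, tau n ^ k = T ^ k * sigma ^ k * mu n ^ k).
{ intros k; unfold tau, T; now rewrite !Rpow_mult_distr. }
unfold weight; rewrite !Et.
pose proof (pow_lt _ n HT) as HTn; pose proof (pow_lt _ j HT) as HTj.
pose proof (pow_lt _ n Hsigma) as Hsn; pose proof (pow_lt _ j Hsigma) as Hsj.
pose proof (pow_lt _ n Hmun) as Hmn.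
assert (HBn : 0 < B ^ S (n + j)) by (apply pow_lt; lra).
replace (c * (sigma ^ n * INR (fact n) * M n) *
  (T ^ j * sigma ^ j * mu n ^ j / (T ^ n * sigma ^ n * mu n ^ n * INR (fact n))) *
  (B ^ S (n + j) * (INR (fact j) * V))) with
  ((c * sigma ^ j * INR (fact j) * (T ^ j / T ^ n) * B ^ S (n + j) / mu n ^ n) *
   (M n * mu n ^ j * V)) by (field; lra).
eapply Rle_trans; [apply Rmult_le_compat_l; [|apply Hminorant]|].
- apply Rdiv_le_0_compat; [|trivial].
  apply Rmult_le_pos; [|lra].
  apply Rmult_le_pos; [|apply Rlt_le, Rdiv_lt_0_compat; trivial].
  apply Rmult_le_pos; [|lra]; apply Rmult_le_pos; lra.
- right.
  assert (E1 : T ^ n = 2 ^ n * a ^ n * B ^ n) by (unfold T; now rewrite !Rpow_mult_distr).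
  assert (E2 : (d * sigma) ^ j = T ^ j * a ^ j * B ^ j * sigma ^ j).
  { rewrite <- !Rpow_mult_distr; f_equal; unfold d, T; ring. }
  assert (0 < 2 ^ n) by (apply pow_lt; lra).
  assert (0 < a ^ n) by (apply pow_lt; lra).
  assert (0 < B ^ n) by (apply pow_lt; lra).
  rewrite E2, E1, pow_inv, !pow_add; simpl (B ^ S _); rewrite pow_add.
  field; lra.
Qed.

Definition ext_fun (lambda : nat -> C) (j : nat) (z : C) : C :=
  Csum (fun n => ext_term s L tau lambda n j z).

Lemma Cderive_ext_fun lambda c j z :
  Lambda_adm M sigma lambda c -> Rabs (snd z) < gamma * PI / 2 ->
  Cderive (ext_fun lambda j) z (Cexp z * ext_fun lambda (S j) z)%C.
Proof.
intros Hl; apply (Cderive_Csum _ (fun n j z => ext_term s L tau lambda n j z)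
  (fun j => c * B * weight M (d * sigma) j)).
- intros n i w _; apply Cderive_ext_term; [lra|apply tau_pos].
- intros i w Hw; now apply ext_term_bound.
Qed.

Lemma ext_fun_adm lambda c :
  Lambda_adm M sigma lambda c ->
  A_adm M (d * sigma) gamma
    (fun w : sector gamma => ext_fun lambda 0 (logz (proj1_sig w))) (4 * B * c).
Proof.
intros Hl.
assert (HD : forall j z, Rabs (snd z) < gamma * PI / 2 ->
  Cderive (ext_fun lambda j) z (Cexp z * ext_fun lambda (S j) z)%C)
  by (intros j z Hz; now apply (Cderive_ext_fun lambda c)).
repeat split.
- destruct Hl as [Hc _]; apply Rmult_le_pos; lra.
- exact (holomorphic_chart gamma (ext_fun lambda) HD).
- intros j z; rewrite (Deriv_n_chart gamma (ext_fun lambda) HD).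
  eapply Rle_trans; [apply (geom_bounded_series _ (c * B * weight M (d * sigma) j))|right; ring].
  apply ext_term_bound; trivial; exact (proj2_sig z).
Qed.

Lemma ext_fun_Borel lambda c :
  Lambda_adm M sigma lambda c ->
  is_Borel (fun w : sector gamma => ext_fun lambda 0 (logz (proj1_sig w))) lambda.
Proof.
intros Hl.
assert (HD : forall j z, Rabs (snd z) < gamma * PI / 2 ->
  Cderive (ext_fun lambda j) z (Cexp z * ext_fun lambda (S j) z)%C)
  by (intros j z Hz; now apply (Cderive_ext_fun lambda c)).
intros j; rewrite (Deriv_n_chart gamma (ext_fun lambda) HD).
intros P HP; destruct (C_locally_Cmod _ _ HP) as [eps [He HeP]].
set (K := 4 * (c * B * weight M (d * sigma) (S j))).
assert (HK : 0 < Rabs K + 1) by (pose proof (Rabs_pos K); lra).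
assert (Hr : 0 < eps / (Rabs K + 1)) by now apply Rdiv_lt_0_compat.
(* At modulus r the distance to lambda_j is at most K r, uniformly in the argument, as the filter at
   the vertex requires. *)
exists (mkposreal _ Hr); intros r Hball Hr0 z Hz Hs; apply HeP; cbn [proj1_sig].
change (Rabs (r - 0) < eps / (Rabs K + 1)) in Hball.
rewrite Rminus_0_r, Rabs_pos_eq in Hball by lra.
eapply Rle_lt_trans; [apply (Csum_limit (gamma * PI / 2) (fun n j z => ext_term s L tau lambda n j z)
  (fun j => c * B * weight M (d * sigma) j) lambda)|].
- intros n i w _; apply Cderive_ext_term; [lra|apply tau_pos].
- intros i w Hw; now apply ext_term_bound.
- intros n i; apply ext_term_limit; [trivial|apply tau_pos].
- exact Hs.
- unfold logz; cbn [fst]; rewrite exp_ln, Hz by apply modulus_pos.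
  rewrite <- Rmult_assoc; fold K.
  apply Rmult_lt_compat_r with (r := Rabs K + 1) in Hball; trivial.
  replace (eps / (Rabs K + 1) * (Rabs K + 1)) with eps in Hball by (field; lra).
  pose proof (Rle_abs K); nra.
Qed.

Lemma ext_fun_adm_ex (lambda : Lambda M sigma) :
  exists c, A_gauge M (d * sigma) gamma
    (fun w : sector gamma => ext_fun lambda 0 (logz (proj1_sig w))) c.
Proof.
destruct (gfun_adm lambda) as [c Hc]; exists (4 * B * c); exact (ext_fun_adm lambda c Hc).
Qed.

Definition extension (lambda : Lambda M sigma) : A_space M (d * sigma) gamma :=
  mkGaugeSpace _ (ext_fun_adm_ex lambda).

Lemma extension_linear : is_linear extension.
Proof.
constructor.
- intros f g; apply gauge_space_eq; intros w; simpl.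
  destruct (gfun_adm f) as [c Hc], (gfun_adm g) as [e He].
  unfold ext_fun; erewrite <- Csum_plus;
    [|apply (ext_term_bound _ _ _ (logz (proj1_sig w)) Hc (proj2_sig w))|apply (ext_term_bound _ _ _ (logz (proj1_sig w)) He (proj2_sig w))].
  apply Csum_ext; intros n; unfold ext_term; simpl; ring.
- intros k f; apply gauge_space_eq; intros w; simpl.
  destruct (gfun_adm f) as [c Hc].
  unfold ext_fun; erewrite <- Csum_scal;
    [|apply (ext_term_bound _ _ _ (logz (proj1_sig w)) Hc (proj2_sig w))].
  apply Csum_ext; intros n; unfold ext_term; simpl; ring.
(* [is_linear] includes a norm bound, which is the continuity. The norm being an infimum, it is
   approached by admissible constants. *)
- exists (4 * B); split; [lra|]; intros f.
  change (gs_norm _ (extension f) <= 4 * B * gs_norm _ f).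
  apply le_epsilon; intros eps Heps.
  destruct (gs_norm_approx _ f (eps / (4 * B))) as [c [Hc Ac]].
  { apply Rdiv_lt_0_compat; lra. }
  apply Rle_trans with (4 * B * c).
  + apply gs_norm_le; exact (ext_fun_adm f c Ac).
  + apply Rle_trans with (4 * B * (gs_norm _ f + eps / (4 * B))).
    * apply Rmult_le_compat_l; lra.
    * right; field; lra.
Qed.

End Extension.

Theorem theorem3p2p1 (M : nat -> R) (HM : strongly_regular M)
    (gamma : R) (Hgamma0 : 0 < gamma)
    (Hgamma : Rbar_lt (Finite gamma) (growth_index M)) :
  exists d : R, 1 <= d /\
    forall sigma : R, 0 < sigma ->
      exists T : Lambda M sigma -> A_space M (d * sigma) gamma,
        is_linear T /\
        forall lambda : Lambda M sigma, is_Borel (T lambda) lambda.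
Proof.
pose proof (strongly_regular_pos M HM) as Hpos.
destruct (property_P_of_lt_growth_index M gamma Hgamma0 Hgamma) as [s [Hs HP]].
assert (Hg : 0 < gamma < s) by lra.
destruct (property_P_gevrey_minorant M s Hpos HP) as [a [mu [Ha [Hmu Hmin]]]].
destruct (INR_unbounded s) as [L HL].
destruct (Phi_bound s gamma L Hg (Rlt_le _ _ HL)) as [B [HB HPhi]].
exists (2 * (a * B) ^ 2); split.
(* The constant is fixed before sigma: a comes from (P_s) for M, and B from s, gamma and L alone. *)
{ pose proof (pow_R1_Rle (a * B) 2 ltac:(nra)); lra. }
intros sigma Hsigma.
exists (extension M s gamma a B sigma L mu Hg Ha HB Hsigma Hmu Hmin HPhi); split.
- apply extension_linear.
- intros lambda; destruct (gfun_adm lambda) as [c Hc].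
  exact (ext_fun_Borel M s gamma a B sigma L mu Hg Ha HB Hsigma Hmu Hmin HPhi lambda c Hc).
Qed.
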